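(* Let $n\ge 8$ be an integer and $G$ an arbitrary (not necessarily connected) graph of order $n$. Then $|M_G|\le q(n)$, where, writing $t$ for a positive integer, \[ q(n)=\begin{cases} 10^{t} & \text{if } n=5t;\\ 15\cdot 10^{t-1} & \text{if } n=5t+1;\\ 225\cdot 10^{t-2} & \text{if } n=5t+2;\\ 36\cdot 10^{t-1} & \text{if } n=5t+3;\\ 6\cdot 10^{t} & \text{if } n=5t+4, \end{cases} \] with equality if and only if \[ G=\begin{cases} tK_5 & \text{if } n=5t;\\ K_6\cup (t-1)K_5 & \text{if } n=5t+1;\\ 2K_6\cup (t-2)K_5 & \text{if } n=5t+2;\\ 2K_4\cup (t-1)K_5 & \text{if } n=5t+3;\\ K_4\cup tK_5 & \text{if } n=5t+4. \end{cases} \]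
   Context: Graphs are finite, simple, undirected. An induced matching is a matching whose endpoints induce a $1$-regular subgraph; it is maximal if not properly contained in another induced matching; $M_G$ is the set of maximal induced matchings of $G$. $K_r$ is the complete graph on $r$ vertices, $G\cup H$ is the disjoint union, $sH$ is the disjoint union of $s$ copies of $H$ (with $0H$ the empty graph). *)

(* Defs.v *)
From mathcomp Require Import all_boot.
Set Implicit Arguments. Unset Strict Implicit. Unset Printing Implicit Defensive.

Definition simple_graph (T : finType) (g : rel T) : Prop :=
  symmetric g /\ irreflexive g.

Section Matchings.
Variables (T : finType) (g : rel T).

Definition is_edge (E : {set T}) : bool :=
  [exists x, exists y, (x != y) && g x y && (E == [set x; y])].

Definition is_matching (M : {set {set T}}) : bool :=
  [forall E in M, is_edge E] &&
  [forall E1 in M, forall E2 in M, (E1 != E2) ==> [disjoint E1 & E2]].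

Definition is_induced_matching (M : {set {set T}}) : bool :=
  is_matching M &&
  [forall x in cover M, #|[set y in cover M | g x y]| == 1].

Definition is_maximal_induced_matching (M : {set {set T}}) : bool :=
  is_induced_matching M &&
  [forall M' : {set {set T}}, (M \proper M') ==> ~~ is_induced_matching M'].

Definition num_max_induced_matchings : nat :=
  #|[set M : {set {set T}} | is_maximal_induced_matching M]|.

End Matchings.

Definition cliques_vtx (s : seq nat) : finType :=
  {i : 'I_(size s) & 'I_(nth 0 s i)}.

Definition cliques_rel (s : seq nat) : rel (cliques_vtx s) :=
  fun u v => (tag u == tag v) && (u != v).

Definition graph_iso (T T' : finType) (g : rel T) (g' : rel T') : Prop :=
  exists f : T -> T', bijective f /\ forall x y, g x y = g' (f x) (f y).

Definition q_bound (n : nat) : nat :=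
  let t := n %/ 5 in
  match n %% 5 with
  | 0 => 10 ^ t
  | 1 => 15 * 10 ^ (t - 1)
  | 2 => 225 * 10 ^ (t - 2)
  | 3 => 36 * 10 ^ (t - 1)
  | _ => 6 * 10 ^ t
  end.

Definition extremal_sizes (n : nat) : seq nat :=
  let t := n %/ 5 in
  match n %% 5 with
  | 0 => nseq t 5
  | 1 => 6 :: nseq (t - 1) 5
  | 2 => 6 :: 6 :: nseq (t - 2) 5
  | 3 => 4 :: 4 :: nseq (t - 1) 5
  | _ => 4 :: nseq t 5
  end.

(* Main.v *)
Require Import Defs.
From mathcomp Require Import all_boot zify.
Set Implicit Arguments. Unset Strict Implicit. Unset Printing Implicit Defensive.

(** An induced matching is determined by its vertex set, so we count the maximal
    vertex sets [S] of an induced subgraph [G[A]] that induce a 1-regular graph.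
    If such an [S] misses [v], it is maximal in [G[A] - v]; if it contains the
    edge [xy], then [S - {x, y}] is maximal in [G[A]] minus [N[x]] and [N[y]].
    Hence the number [f] of these sets satisfies
      [f(A) <= f(A - v) + sum over w in N(v) of f(A - N[v] - N[w])],
    and, branching on all of [N(v)],
      [f(A) <= f(A - N[v]) + sum over edges xy meeting N(v) of f(A - N[x] - N[y])],
    where the first term disappears as soon as some [w] in [N(v)] has
    [N[w] <= N[v]].  Induction on [#|A|] with the rational bound
    [1, 3/2, 9/4, 18/5, 6] times [10 ^ t] closes every case: the first inequality
    handles a vertex of degree at least 5 (tie: [K_6]), of degree at most 1, and
    of degree 4 (tie: [K_5]); the second one handles graphs whose degrees are 2
    and 3 (tie: [K_4]). *)

(** * The numerical bound *)

(** The induction has to run through all orders, while the formula is claimed only from order 8 on: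
    deleting neighbourhoods leads to arbitrary small graphs. Continuing it downwards by division by
    10 leaves the empty graph as the only base case, at the price of values that are not attained at
    some small orders. The first inequality is too weak at low degree: [Q (n - 1) + 2 * Q (n - 3)]
    exceeds [Q n] for n = 3 mod 5, and [Q (n - 1) + 3 * Q (n - 4)] exceeds it for n = 4 mod 5. The
    price of the second one is to exhibit, for each edge near v, enough distinct vertices in the two
    closed neighbourhoods; degree conditions and excluded configurations supply them. Uniqueness is
    carried along: a tie with K_4 or K_6 restricts n mod 5, and only for these residues does adding
    that clique turn one extremal list into another. *)

(* Twenty times the bound, for every [n]: the factor makes the small cases
   [3/2], [9/4] and [18/5] integral, and makes the recursion uniform.  Equality
   [20 * f = Q n] is impossible for [n = 1, 2, 3, 7] by divisibility. *)
Definition Q n := nth 0 [:: 20; 30; 45; 72; 120] (n %% 5) * 10 ^ (n %/ 5).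

Lemma Q_add5 n : Q n.+4.+1 = 10 * Q n.
Proof.
rewrite /Q (_ : n.+4.+1 = n + 5); last by lia.
by rewrite modnDr divnDr // divnn /= addn1 expnS; lia.
Qed.

(** Five consecutive values are fixed multiples of one unknown [P], with one case per residue mod 5.
    This removes the powers of 10, and inequalities between shifted values of [Q] become linear in
    [P]. *)
Lemma Q_table m : exists2 P, 0 < P &
  [\/ [/\ Q m = 20 * P, Q m.+1 = 30 * P, Q m.+2 = 45 * P, Q m.+3 = 72 * P & Q m.+4 = 120 * P],
      [/\ Q m = 30 * P, Q m.+1 = 45 * P, Q m.+2 = 72 * P, Q m.+3 = 120 * P & Q m.+4 = 200 * P],
      [/\ Q m = 45 * P, Q m.+1 = 72 * P, Q m.+2 = 120 * P, Q m.+3 = 200 * P & Q m.+4 = 300 * P] |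
      [/\ Q m = 72 * P, Q m.+1 = 120 * P, Q m.+2 = 200 * P, Q m.+3 = 300 * P & Q m.+4 = 450 * P]
   \/ [/\ Q m = 120 * P, Q m.+1 = 200 * P, Q m.+2 = 300 * P,
     Q m.+3 = 450 * P & Q m.+4 = 720 * P]].
Proof.
elim/ltn_ind: m => m IH; case: (ltnP m 5) => [|m5].
  case: m IH => [|[|[|[|[|//]]]]] _ _; exists 1 => //.
  - by constructor 1. - by constructor 2. - by constructor 3.
  - by constructor 4; left. - by constructor 4; right.
have -> : m = (m - 5).+4.+1 by lia.
have [P P0 HP] := IH (m - 5) ltac:(lia); exists (10 * P); first lia.
rewrite !Q_add5.
case: HP => [[-> -> -> -> ->]|[-> -> -> -> ->]|[-> -> -> ->
  ->]|[[-> -> -> -> ->]|[-> -> -> -> ->]]].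
- by constructor 1; split; lia.
- by constructor 2; split; lia.
- by constructor 3; split; lia.
- by constructor 4; left; split; lia.
- by constructor 4; right; split; lia.
Qed.

Ltac qlia m :=
  rewrite ?subSS ?subn0 ?Q_add5; let P := fresh "P" in let P0 := fresh "P0" in
  have [P P0] := Q_table m;
  case=> [[? ? ? ? ?]|[? ? ? ? ?]|[? ? ? ? ?]|[[? ? ? ? ?]|[? ? ? ? ?]]]; lia.

(** 3/2 is the smallest ratio of consecutive values, attained exactly for n = 0, 1 mod 5; it
    reflects the passage from K_5 with 10 edges to K_6 with 15. *)
Lemma Q_step n : 3 * Q n <= 2 * Q n.+1.
Proof. qlia n. Qed.

Lemma Q_ltS n : Q n < Q n.+1.
Proof. qlia n. Qed.

Lemma Q_le m n : m <= n -> Q m <= Q n.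
Proof.
elim: n => [|n IH]; first by rewrite leqn0 => /eqP ->.
rewrite leq_eqVlt ltnS => /orP [/eqP -> //|/IH H].
exact: leq_trans H (ltnW (Q_ltS n)).
Qed.

Lemma Q_sub_comp4 n : 4 <= n -> 6 * Q (n - 4) <= Q n.
Proof. case: n => [|[|[|[|m]]]] // _; qlia m. Qed.

Lemma Q_sub_branch4 n : 6 <= n -> Q (n - 1) + 2 * Q (n - 5) + 2 * Q (n - 6) <= Q n.
Proof. case: n => [|[|[|[|[|[|m]]]]]] // _; qlia m. Qed.

Lemma Q_sub_branch5 n : 6 <= n -> Q (n - 1) + 5 * Q (n - 6) <= Q n.
Proof. case: n => [|[|[|[|[|[|m]]]]]] // _; qlia m. Qed.

Lemma Q_sub_branch6 n d : 6 <= d < n -> Q (n - 1) + d * Q (n - d.+1) < Q n.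
Proof.
move=> /andP [d6 dn].
(* The product decreases in d: one more neighbour gains a factor of at most 7/6 and loses at least
   3/2. So d = 6 is the worst case. *)
have H : d * Q (n - d.+1) <= 6 * Q (n - 7).
  elim: d d6 dn => // d IH d6 dn; case: (ltnP d 6) => d6'.
    by have -> : d = 5 by lia.
  apply: leq_trans (IH d6' (ltnW dn)).
  have -> : n - d.+1 = (n - d.+2).+1 by lia.
  have := Q_step (n - d.+2); nia.
have n7 : 7 <= n by lia.
suff : Q (n - 1) + 6 * Q (n - 7) < Q n by lia.
case: n n7 {H dn} => [|[|[|[|[|[|[|m]]]]]]] // _; qlia m.
Qed.

Lemma Q_euclid t r : r < 5 -> Q (t * 5 + r) = nth 0 [:: 20; 30; 45; 72; 120] r * 10 ^ t.
Proof. by move=> r5; rewrite /Q modnMDl modn_small // divnMDl // divn_small // addn0. Qed.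

Lemma sizes_euclid t r : r < 5 -> extremal_sizes (t * 5 + r) =
  match r with
  | 0 => nseq t 5
  | 1 => 6 :: nseq (t - 1) 5
  | 2 => 6 :: 6 :: nseq (t - 2) 5
  | 3 => 4 :: 4 :: nseq (t - 1) 5
  | _ => 4 :: nseq t 5
  end.
Proof. by move=> r5; rewrite /extremal_sizes modnMDl modn_small // divnMDl // divn_small //
  addn0. Qed.

(** The tie forces n = 3 or 4 mod 5, the orders whose extremal graph contains K_4; the other
    residues contradict it. *)
Lemma sizes_cons4 n : 4 <= n -> 6 * Q (n - 4) = Q n ->
  extremal_sizes n = 4 :: extremal_sizes (n - 4).
Proof.
move=> n4; have := divn_eq (n - 4) 5; have : (n - 4) %% 5 < 5 by rewrite ltn_mod.
move: ((n - 4) %/ 5) ((n - 4) %% 5) => t r r5 E.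
have E4 : 10 ^ t > 0 by rewrite expn_gt0.
rewrite E; case: r r5 E => [|[|[|[|[|//]]]]] _ E.
- by rewrite (_ : n = t * 5 + 4) ?sizes_euclid //; lia.
- rewrite (_ : n = t.+1 * 5 + 0); last lia. rewrite !Q_euclid //= expnS; lia.
- rewrite (_ : n = t.+1 * 5 + 1); last lia. rewrite !Q_euclid //= expnS; lia.
- rewrite (_ : n = t.+1 * 5 + 2); last lia. rewrite !Q_euclid //= expnS; lia.
- by rewrite (_ : n = t.+1 * 5 + 3) ?sizes_euclid ?subn1 //; lia.
Qed.

(** By [Q_add5] the tie reads [3 * Q (n - 6) = 2 * Q (n - 5)], which leaves n = 1 or 2 mod 5, the
    orders whose extremal graph contains K_6. *)
Lemma sizes_cons6 n : 6 <= n -> Q (n - 1) + 5 * Q (n - 6) = Q n ->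
  extremal_sizes n = 6 :: extremal_sizes (n - 6).
Proof.
move=> n6; have := divn_eq (n - 6) 5; have : (n - 6) %% 5 < 5 by rewrite ltn_mod.
move: ((n - 6) %/ 5) ((n - 6) %% 5) => t r r5 E.
have E4 : 10 ^ t > 0 by rewrite expn_gt0.
rewrite E; case: r r5 E => [|[|[|[|[|//]]]]] _ E.
- by rewrite (_ : n = t.+1 * 5 + 1) ?sizes_euclid ?subn1 //; lia.
- by rewrite (_ : n = t.+1 * 5 + 2) ?sizes_euclid //; lia.
- rewrite (_ : n = t.+1 * 5 + 3); last lia.
  rewrite (_ : _ - 1 = t.+1 * 5 + 2); last lia. rewrite !Q_euclid //= expnS; lia.
- rewrite (_ : n = t.+1 * 5 + 4); last lia.
  rewrite (_ : _ - 1 = t.+1 * 5 + 3); last lia. rewrite !Q_euclid //= expnS; lia.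
- rewrite (_ : n = t.+2 * 5 + 0); last lia.
  rewrite (_ : _ - 1 = t.+1 * 5 + 4); last lia. rewrite !Q_euclid //= !expnS; lia.
Qed.

(** Either tie occurs only for n = 1, 2 mod 5, and then order n - 1 has an extremal graph built from
    K_5 and K_6 alone. Its degrees are at least 4, so the neighbours of a deleted vertex had degree
    at least 5. *)
Lemma sizes_ge5 n : 6 <= n ->
  Q (n - 1) + 5 * Q (n - 6) = Q n \/ Q (n - 1) + 2 * Q (n - 5) + 2 * Q (n - 6) = Q n ->
  all (leq 5) (extremal_sizes (n - 1)).
Proof.
move=> n6; have := divn_eq (n - 6) 5; have : (n - 6) %% 5 < 5 by rewrite ltn_mod.
move: ((n - 6) %/ 5) ((n - 6) %% 5) => t r r5 E.
have E4 : 10 ^ t > 0 by rewrite expn_gt0.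
have all5 k : all (leq 5) (nseq k 5) by rewrite all_nseq orbT.
rewrite E; case: r r5 E => [|[|[|[|[|//]]]]] _ E.
- by rewrite (_ : n - 1 = t.+1 * 5 + 0) ?sizes_euclid //; lia.
- by rewrite (_ : n - 1 = t.+1 * 5 + 1) ?sizes_euclid //=; lia.
- rewrite (_ : n - 1 = t.+1 * 5 + 2); last lia.
  rewrite (_ : n - 5 = t * 5 + 3); last lia.
  rewrite (_ : n = t.+1 * 5 + 3); last lia. rewrite !Q_euclid //= expnS; lia.
- rewrite (_ : n - 1 = t.+1 * 5 + 3); last lia.
  rewrite (_ : n - 5 = t * 5 + 4); last lia.
  rewrite (_ : n = t.+1 * 5 + 4); last lia. rewrite !Q_euclid //= expnS; lia.
- rewrite (_ : n - 1 = t.+1 * 5 + 4); last lia.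
  rewrite (_ : n - 5 = t.+1 * 5 + 0); last lia.
  rewrite (_ : n = t.+2 * 5 + 0); last lia. rewrite !Q_euclid //= !expnS; lia.
Qed.

(** Divisibility by 20 excludes n = 1, 2, 3, 7, where the truncated [t - 1] or [t - 2] breaks the
    pattern: orders 1 and 6 have the same list. *)
Lemma sizes_rcons5 n : 20 %| Q n -> extremal_sizes (n + 5) = rcons (extremal_sizes n) 5.
Proof.
have rn k x : rcons (nseq k x) x = nseq k.+1 x by elim: k => //= k ->.
rewrite (divn_eq n 5) addnAC -mulSnr; have : n %% 5 < 5 by rewrite ltn_mod.
move: (n %/ 5) (n %% 5) => t r r5; rewrite Q_euclid // !sizes_euclid //.
case: r r5 => [|[|[|[|[|//]]]]] _ /=; rewrite ?rn // ?subSS ?subn0.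
- by case: t => // t _; rewrite subn1.
- by case: t => [|[|t]] // _; rewrite !subSS !subn0.
- by case: t => // t _; rewrite subn1.
Qed.

(** From order 8 on, [t - 1] and [t - 2] are true subtractions in the branches that use them; at n =
    7 the identity fails. *)
Lemma q_boundE n : 8 <= n -> Q n = 20 * q_bound n.
Proof.
move=> n8; have := divn_eq n 5; have : n %% 5 < 5 by rewrite ltn_mod.
rewrite /Q /q_bound; move: (n %/ 5) (n %% 5) => t r r5 E.
case: r r5 E => [|[|[|[|[|//]]]]] _ E /=; rewrite ?mulnA //.
- by have -> : t = (t - 1).+1; [lia | rewrite subSS subn0 expnS; lia].
- by have -> : t = (t - 2).+2; [lia | rewrite !subSS subn0 !expnS; lia].
- by have -> : t = (t - 1).+1; [lia | rewrite subSS subn0 expnS; lia].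
Qed.

Lemma prod_sizes n : 8 <= n -> \prod_(k <- extremal_sizes n) 'C(k, 2) = q_bound n.
Proof.
move=> n8; have P k : \prod_(i <- nseq k 5) 'C(i, 2) = 10 ^ k.
  by elim: k => [|k IH]; rewrite ?big_nil // big_cons IH expnS.
rewrite /extremal_sizes /q_bound.
by case: (n %% 5) => [|[|[|[|r]]]]; rewrite ?big_cons P ?mulnA.
Qed.

(** [e] is the degree of the neighbour of a leaf. This sum and the following ones come from
    branchings without a tie, so strictness settles their cases with nothing to say about extremal
    graphs. *)
Lemma Q_sub_leaf n e : 0 < e <= 4 -> e < n -> Q (n - 2) + e * Q (n - e.+1) < Q n.
Proof.
case: e => [|[|[|[|[|//]]]]] // _.
- case: n => [|[|m]] // _; qlia m.
- case: n => [|[|[|m]]] // _; qlia m.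
- case: n => [|[|[|[|m]]]] // _; qlia m.
- case: n => [|[|[|[|[|m]]]]] // _; qlia m.
Qed.

Lemma Q_sub_cut n e : 2 <= e <= 4 -> 6 <= n ->
  6 * Q (n - 5) + (Q (n - 6) + e.-1 * Q (n - e.+1)) < Q n.
Proof.
case: e => [|[|[|[|[|//]]]]] // _; case: n => [|[|[|[|[|[|m]]]]]] // _ /=; qlia m.
Qed.

Lemma Q_sub_diamond1 n : 5 <= n -> 3 * Q (n - 4) + 3 * Q (n - 5) < Q n.
Proof. case: n => [|[|[|[|[|m]]]]] // _; qlia m. Qed.

Lemma Q_sub_diamond2 n : 5 <= n -> Q (n - 4) + 6 * Q (n - 5) < Q n.
Proof. case: n => [|[|[|[|[|m]]]]] // _; qlia m. Qed.

Lemma Q_sub_triangle0 n : 3 <= n -> 3 * Q (n - 3) < Q n.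
Proof. case: n => [|[|[|m]]] // _; qlia m. Qed.

Lemma Q_sub_triangle1 n : 4 <= n -> Q (n - 3) + 3 * Q (n - 4) < Q n.
Proof. case: n => [|[|[|[|m]]]] // _; qlia m. Qed.

Lemma Q_sub_triangle2 n : 5 <= n -> Q (n - 3) + 2 * Q (n - 4) + 3 * Q (n - 5) < Q n.
Proof. case: n => [|[|[|[|[|m]]]]] // _; qlia m. Qed.

Lemma Q_sub_deg2 n : 4 <= n -> Q (n - 3) + 4 * Q (n - 4) < Q n.
Proof. case: n => [|[|[|[|m]]]] // _; qlia m. Qed.

Lemma Q_sub_cubic1 n : 6 <= n -> Q (n - 4) + 7 * Q (n - 5) + Q (n - 6) < Q n.
Proof. case: n => [|[|[|[|[|[|m]]]]]] // _; qlia m. Qed.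

Lemma Q_sub_cubic0 n : 6 <= n -> Q (n - 4) + 6 * Q (n - 5) + 3 * Q (n - 6) < Q n.
Proof. case: n => [|[|[|[|[|[|m]]]]]] // _; qlia m. Qed.

(** * Branching *)

Section Counting.
Variables (T : finType) (g : rel T).

Definition reg1 (S : {set T}) : bool :=
  [forall x in S, #|[set y in S | g x y]| == 1].

Definition mx (A : {set T}) (S : {set T}) : bool :=
  maxset (fun S : {set T} => reg1 S && (S \subset A)) S.

Definition num_mx (A : {set T}) : nat := #|[set S | mx A S]|.

Definition adj_in (A : {set T}) (x y : T) : bool := [&& x \in A, y \in A & g x y].

Definition nb_in (A : {set T}) (x : T) : {set T} := [set y | adj_in A x y].

Definition cl_in (A : {set T}) (x y : T) : {set T} :=
  [set z | [|| z == x, z == y, adj_in A x z | adj_in A y z]].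

Hypotheses (gS : symmetric g) (gI : irreflexive g).

Lemma reg1P (S : {set T}) : reflect
  (forall x, x \in S -> exists y, [/\ y \in S, g x y & forall z, z \in S -> g x z -> z = y])
  (reg1 S).
Proof.
apply: (iffP forall_inP) => H x xS.
  have /cards1P [y Ey] := H x xS.
  have : y \in [set y in S | g x y] by rewrite Ey set11.
  rewrite inE => /andP [yS gxy]; exists y; split=> // z zS gxz.
  by apply/set1P; rewrite -Ey inE zS.
have [y [yS gxy Hy]] := H x xS; apply/cards1P; exists y.
apply/setP => z; rewrite !inE; apply/andP/eqP => [[zS gxz]|->]; last by split.
exact: Hy.
Qed.

Lemma adjS A : symmetric (adj_in A).
Proof. by move=> x y; rewrite /adj_in gS andbCA. Qed.

Lemma adjI A : irreflexive (adj_in A).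
Proof. by move=> x; rewrite /adj_in gI !andbF. Qed.

Lemma adj_neq A x y : adj_in A x y -> x != y.
Proof. by apply: contraTneq => ->; rewrite adjI. Qed.

Lemma mxP (A S : {set T}) : reflect
  [/\ reg1 S, S \subset A & forall S', reg1 S' -> S' \subset A -> S \subset S' -> S' = S]
  (mx A S).
Proof.
apply: (iffP maxsetP) => [[/andP[? ?] H]|[? ? H]].
  by split=> // S' *; apply: H => //; apply/andP.
by split=> [|B /andP [? ?] ?]; [apply/andP | exact: H].
Qed.

Lemma mx_sub (A B S : {set T}) : mx A S -> S \subset B -> B \subset A -> mx B S.
Proof.
move=> /mxP [rS SA H] SB BA; apply/mxP; split=> // S' r' S'B; apply: H => //.
exact: subset_trans BA.
Qed.

Lemma mx_mate A S x : mx A S -> x \in S -> exists2 y, y \in S & adj_in A x y.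
Proof.
move=> /mxP [/reg1P rS /subsetP SA _] xS; have [y [yS gxy _]] := rS x xS.
by exists y => //; rewrite /adj_in gxy !SA.
Qed.

Lemma mx_mate_uniq A S x y z : mx A S -> x \in S -> y \in S -> z \in S ->
  g x y -> g x z -> y = z.
Proof.
move=> /mxP [/reg1P rS _ _] xS yS zS gxy gxz; have [u [_ _ H]] := rS x xS.
by rewrite (H y) // (H z).
Qed.

Lemma reg1_add S x y : reg1 S -> g x y ->
  (forall z, z \in S -> ~~ g x z /\ ~~ g y z) -> reg1 (x |: (y |: S)).
Proof.
move=> /reg1P rS gxy H; have gyx : g y x by rewrite gS.
apply/reg1P => u; rewrite !inE => /or3P [/eqP->|/eqP->|uS].
- exists y; split; rewrite ?inE ?eqxx ?orbT // => z.
  rewrite !inE => /or3P [/eqP->|/eqP->//|zS]; first by rewrite gI.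
  by move=> gz; have [] := H z zS; rewrite gz.
- exists x; split; rewrite ?inE ?eqxx ?orbT // => z.
  rewrite !inE => /or3P [/eqP->//|/eqP->|zS]; first by rewrite gI.
  by move=> gz; have [_] := H z zS; rewrite gz.
- have [w [wS guw Hw]] := rS u uS; have [nx ny] := H u uS.
  exists w; split; rewrite ?inE ?wS ?orbT // => z.
  rewrite !inE => /or3P [/eqP->|/eqP->|zS]; last exact: Hw.
    by rewrite gS (negPf nx).
  by rewrite gS (negPf ny).
Qed.

(** If [S] missed both closed neighbourhoods, the edge could be added to it. This is what removes
    the first term of the second branching inequality. *)
Lemma mx_block A S x y : mx A S -> adj_in A x y -> exists2 z, z \in S & z \in cl_in A x y.
Proof.
move=> /mxP [rS SA H] hxy; apply/exists_inP; apply: contraT; rewrite negb_exists_in.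
move=> /forall_inP N; have /and3P [xA yA gxy] := hxy.
suff E : x |: (y |: S) = S.
  by have := N x; rewrite -E !inE eqxx /= => /(_ isT).
apply: H.
- apply: reg1_add => // z zS; have := N z zS; have zA := subsetP SA _ zS.
  by rewrite !inE /adj_in xA yA zA /= !negb_or => /and4P [].
- by rewrite !subUset !sub1set xA yA.
- by rewrite setUA subsetUr.
Qed.

Lemma mx_cl A S x y : mx A S -> x \in S -> y \in S -> adj_in A x y ->
  S :&: cl_in A x y \subset [set x; y].
Proof.
move=> mS xS yS /and3P [_ _ gxy]; apply/subsetP => z; rewrite !inE => /andP [zS].
case/or4P=> [->//|->|/and3P [_ _ gz]|/and3P [_ _ gz]]; rewrite ?orbT //.
  by rewrite -(mx_mate_uniq mS xS yS zS gxy gz) eqxx orbT.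
by rewrite -(@mx_mate_uniq A S y x z) ?eqxx // gS.
Qed.

(** A 1-regular set inside [A :\: R] has no neighbour of x or y, because [R] contains both closed
    neighbourhoods. Adding x and y back keeps it 1-regular, so maximality passes from [S] to the
    rest. *)
Lemma mx_edge A S x y (R : {set T}) : mx A S -> x \in S -> y \in S -> adj_in A x y ->
  cl_in A x y \subset R -> S :&: R \subset [set x; y] -> mx (A :\: R) (S :\: [set x; y]).
Proof.
move=> mS xS yS hxy /subsetP clR /subsetP SR.
have /mxP [/reg1P rS SA max] := mS; have /and3P [xA yA gxy] := hxy.
have gyx : g y x by rewrite gS.
apply/mxP; split.
- apply/reg1P => u; rewrite !inE negb_or => /andP [/andP [ux uy] uS].
  have [w [wS guw Hw]] := rS u uS.
  exists w; rewrite !inE wS andbT; split=> //.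
    rewrite negb_or; apply/andP; split; apply/eqP => E.
      by move: uy; rewrite (@mx_mate_uniq A S x u y) ?eqxx // gS -E.
    by move: ux; rewrite (@mx_mate_uniq A S y u x) ?eqxx // gS -E.
  by move=> z; rewrite !inE => /andP [_ zS]; apply: Hw.
- apply/subsetP => z; rewrite !inE => /andP [zxy zS]; rewrite (subsetP SA) // andbT.
  by apply: contra zxy => zR; have := SR z; rewrite !inE zS zR; apply.
- move=> S' r' S'A sub.
  have E : x |: (y |: S') = S.
    apply: max.
    + apply: reg1_add => // z /(subsetP S'A); rewrite inE => /andP [zR zA].
      have := contra (clR z) zR; rewrite !inE /adj_in xA yA zA /= !negb_or.
      by move=> /and4P [].
    + rewrite !subUset !sub1set xA yA /=; apply: subset_trans S'A _.
      exact: subsetDl.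
    + apply/subsetP => z zS; have := subsetP sub z; rewrite !inE zS andbT negb_or.
      by case: (z == x) => //; case: (z == y) => //= ->.
  rewrite -E; apply/setP => z; rewrite !inE.
  case zx: (z == x); case zy : (z == y) => //=; apply/negbTE/negP => /(subsetP S'A);
    rewrite inE => /andP [/negP []] ; apply: clR; rewrite inE ?zx ?zy ?orbT //.
Qed.

Lemma card_bigcup_seq (I : Type) (U : finType) (L : seq I) (F : I -> {set U}) :
  #|\bigcup_(i <- L) F i| <= \sum_(i <- L) #|F i|.
Proof.
apply: (big_ind2 (fun (A : {set U}) n => #|A| <= n)) => //; first by rewrite cards0.
move=> A a B b HA HB; apply: leq_trans (leq_add HA HB).
by rewrite cardsU leq_subr.
Qed.

Lemma card_mx_edge A x y (R : {set T}) : adj_in A x y -> cl_in A x y \subset R ->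
  #|[set S | [&& mx A S, x \in S, y \in S & S :&: R \subset [set x; y]]]| <= num_mx (A :\: R).
Proof.
move=> hxy clR.
rewrite -(card_in_imset (f := fun S => S :\: [set x; y])).
  apply: subset_leq_card; apply/subsetP => S0 /imsetP [S]; rewrite inE.
  by move=> /and4P [mS xS yS SR] ->; rewrite inE; apply: mx_edge.
move=> S1 S2; rewrite !inE => /and4P [_ x1 y1 _] /and4P [_ x2 y2 _] /setP E.
apply/setP => z; have := E z; rewrite !inE.
by case: eqP => [->|_]; [rewrite x1 x2 | case: eqP => [->|_ //]; rewrite y1 y2].
Qed.

(* Every maximal [S] is charged to a listed edge [p.1] that it contains, with
   [p.2] a set met by [S] only in that edge, or (when [c] holds) avoids [B]. *)
Lemma nmx_branch A (L : seq (T * T * {set T})) (c : bool) (B : {set T}) :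
  (forall p, p \in L -> adj_in A p.1.1 p.1.2 && (cl_in A p.1.1 p.1.2 \subset p.2)) ->
  (forall S, mx A S ->
     has (fun p => [&& p.1.1 \in S, p.1.2 \in S & S :&: p.2 \subset [set p.1.1; p.1.2]]) L
     || c && [disjoint S & B]) ->
  num_mx A <= c * num_mx (A :\: B) + \sum_(p <- L) num_mx (A :\: p.2).
Proof.
move=> HL HS.
pose F p := [set S | [&& mx A S, p.1.1 \in S,
  p.1.2 \in S & S :&: p.2 \subset [set p.1.1; p.1.2]]].
pose X0 := [set S | [&& c, mx A S & [disjoint S & B]]].
apply: (@leq_trans (#|X0| + #|\bigcup_(p <- L) F p|)).
  rewrite (leq_trans _ (leq_card_setU _ _)) //; apply: subset_leq_card.
  apply/subsetP => S; rewrite !inE => mS; have := HS S mS.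
  rewrite mS => /orP [/hasP [p pL Hp]|-> //].
  apply/orP; right; elim: L pL {HL HS} => // q L IH; rewrite big_cons !inE.
  by case/orP => [/eqP <-|/IH ->]; rewrite ?mS ?Hp ?orbT.
apply: leq_add.
  rewrite /X0; case: (c) => /=; last by rewrite leqn0 cards_eq0; apply/eqP/setP => S;
    rewrite !inE.
  rewrite mul1n; apply: subset_leq_card; apply/subsetP => S; rewrite !inE => /andP [mS dS].
  apply: (mx_sub mS); last exact: subsetDl.
  by rewrite subsetD dS andbT; case/mxP: mS.
apply: leq_trans (card_bigcup_seq _ _) _.
rewrite big_seq [leqRHS]big_seq; apply: leq_sum => p /HL /andP [h1 h2].
exact: card_mx_edge.
Qed.

Lemma nmx_vertex A v :
  num_mx A <= num_mx (A :\ v) + \sum_(w in nb_in A v) num_mx (A :\: cl_in A v w).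
Proof.
pose L := [seq (v, w, cl_in A v w) | w <- enum (nb_in A v)].
rewrite -big_enum /= -(big_map (fun w => (v, w, cl_in A v w)) xpredT
  (fun p => num_mx (A :\: p.2))).
rewrite -[X in X + _]mul1n; apply: (@nmx_branch A _ true [set v]).
  by move=> p /mapP [w]; rewrite mem_enum inE => h -> /=; rewrite h subxx.
move=> S mS; case vS: (v \in S); last by rewrite disjoint_sym disjoints1 vS orbT.
apply/orP; left; have [w wS h] := mx_mate mS vS.
apply/hasP; exists (v, w, cl_in A v w); last by rewrite /= vS wS mx_cl.
by apply/mapP; exists w => //; rewrite mem_enum inE.
Qed.

End Counting.

(** * Components and unions of cliques *)

Section Components.
Variables (T : finType) (g : rel T).
Hypotheses (gS : symmetric g) (gI : irreflexive g).
Implicit Types (A D K S : {set T}).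

Local Notation reg1 := (reg1 g).
Local Notation mx := (mx g).
Local Notation nmx := (num_mx g).
Local Notation adj := (adj_in g).

Lemma nmx_gt0 A : 0 < nmx A.
Proof.
have H : reg1 set0 && (set0 \subset A).
  by rewrite sub0set andbT; apply/reg1P => x; rewrite inE.
have [S mS _] := @maxset_exists _ (fun S => reg1 S && (S \subset A)) _ H.
by rewrite card_gt0; apply/set0Pn; exists S; rewrite inE.
Qed.

(** [D] is a union of connected components of G[A]. *)
Definition closed_in A D := D \subset A /\ forall x y, x \in D -> adj A x y -> y \in D.

Lemma reg1_comp A D S : closed_in A D -> S \subset A ->
  reg1 S = reg1 (S :&: D) && reg1 (S :\: D).
Proof.
move=> [/subsetP DA Dc] /subsetP SA.
have cD x y : x \in S -> y \in S -> g x y -> (x \in D) = (y \in D).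
  move=> xS yS gxy; apply/idP/idP => H; apply: Dc H _; rewrite /adj !SA //.
  by rewrite gS.
apply/reg1P/andP => [rS|[/reg1P r1 /reg1P r2] x xS].
  split; apply/reg1P => x; rewrite inE => /andP [].
    move=> xS xD; have [y [yS gxy H]] := rS x xS.
    exists y; rewrite !inE yS -(cD x) //; split=> // z; rewrite inE => /andP [zS _].
    exact: H.
  move=> xD xS; have [y [yS gxy H]] := rS x xS.
  exists y; rewrite !inE yS -(cD x) // andbT; split=> // z; rewrite inE => /andP [_ zS].
  exact: H.
case xD : (x \in D).
  have [|y [+ gxy H]] := r1 x; first by rewrite inE xS.
  rewrite inE => /andP [yS yD]; exists y; split=> // z zS gxz.
  by apply: H; rewrite // inE zS -(cD x).
have [|y [+ gxy H]] := r2 x; first by rewrite inE xD.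
rewrite inE => /andP [yD yS]; exists y; split=> // z zS gxz.
by apply: H; rewrite // inE zS -(cD x) ?xD.
Qed.

(** 1-regularity and inclusion are checked on the two sides separately, so enlarging one side never
    interferes with the other. *)
Lemma mx_comp A D S : closed_in A D -> S \subset A ->
  mx A S = mx D (S :&: D) && mx (A :\: D) (S :\: D).
Proof.
move=> cAD SA; have [DA _] := cAD.
have U S1 S2 : S1 \subset D -> S2 \subset A :\: D ->
    (S1 :|: S2) :&: D = S1 /\ (S1 :|: S2) :\: D = S2.
  move=> /subsetP s1 /subsetP s2; split; apply/setP => z; rewrite !inE.
    case z1: (z \in S1); first by rewrite s1.
    by case z2 : (z \in S2) => //=; have := s2 z z2; rewrite inE => /andP [/negPf->].
  case z1: (z \in S1) => /=.
    by rewrite s1 //=; apply/esym/negP => /s2; rewrite inE s1.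
  by case z2 : (z \in S2); rewrite ?andbF // andbT; have := s2 z z2; rewrite inE => /andP [].
have SDA : S :\: D \subset A :\: D by apply: setSD.
have SID : S :&: D \subset D by apply: subsetIr.
have UA S1 S2 : S1 \subset D -> S2 \subset A :\: D -> S1 :|: S2 \subset A.
  move=> s1 s2; rewrite subUset (subset_trans s1 DA) (subset_trans s2) //.
  exact: subsetDl.
have ES : S = (S :&: D) :|: (S :\: D) by rewrite setID.
apply/mxP/andP => [[rS _ max]|[/mxP [r1 _ m1] /mxP [r2 _ m2]]].
  move: (rS); rewrite (reg1_comp cAD) // => /andP [r1 r2].
  split; apply/mxP; split=> // S' r' S'D sub.
    have [E1 E2] := U S' (S :\: D) S'D SDA.
    rewrite -[in RHS](max (S' :|: (S :\: D))) ?E1 //.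
    - by rewrite (reg1_comp cAD) ?E1 ?E2 ?r' ?UA.
    - exact: UA.
    - by rewrite {1}ES setSU.
  have [E1 E2] := U (S :&: D) S' SID S'D.
  rewrite -[in RHS](max (S :&: D :|: S')) ?E2 //.
  - by rewrite (reg1_comp cAD) ?E1 ?E2 ?r1 ?r' ?UA.
  - exact: UA.
  - by rewrite {1}ES setUS.
split=> //; first by rewrite (reg1_comp cAD) ?r1.
move=> S'; move=> r' S'A sub; move: r'; rewrite (reg1_comp cAD) // => /andP [r1' r2'].
rewrite -(setID S' D) (m1 _ r1') ?subsetIr ?setSI // (m2 _ r2') ?setSD //.
Qed.

Lemma nmx_comp A D : closed_in A D -> nmx A = nmx D * nmx (A :\: D).
Proof.
move=> cAD; rewrite /num_mx -cardsX.
have mA B S : mx B S -> S \subset B by case/mxP.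
rewrite -(card_in_imset (f := fun S => (S :&: D, S :\: D)) (D := [set S | mx A S])).
  apply: eq_card => -[S1 S2]; rewrite !inE /=; apply/imsetP/andP.
    move=> [S]; rewrite inE => mS [-> ->]; apply/andP.
    by rewrite -mx_comp ?mA.
  move=> [m1 m2]; have s1 := mA _ _ m1; have s2 := mA _ _ m2.
  have E1 : (S1 :|: S2) :&: D = S1.
    rewrite setIUl (setIidPl s1); apply/setUidPl; apply: subset_trans (sub0set _).
    by move: s2; rewrite subsetD => /andP [_]; rewrite -setI_eq0 => /eqP->.
  have E2 : (S1 :|: S2) :\: D = S2.
    rewrite setDUl; move: s1; rewrite -setD_eq0 => /eqP->; rewrite set0U.
    by apply/setDidPl; move: s2; rewrite subsetD => /andP [].
  exists (S1 :|: S2); last by rewrite E1 E2.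
  rewrite inE (mx_comp cAD) ?E1 ?E2 ?m1 //.
  rewrite subUset (subset_trans s1) ?(subset_trans s2) ?subsetDl //; by case: cAD.
by move=> S1 S2 _ _ [E1 E2]; rewrite -(setID S1 D) E1 E2 setID.
Qed.

Lemma mx_uniq_le1 A S0 : (forall S, mx A S -> S = S0) -> nmx A <= 1.
Proof.
move=> H; rewrite -(cards1 S0); apply: subset_leq_card; apply/subsetP => S.
by rewrite !inE => /H ->.
Qed.

Lemma mx_order4 D S : #|D| = 4 -> mx D S -> [\/ S = set0, S = D | #|S| = 2].
Proof.
move=> D4 mS; have /mxP [_ SD _] := mS.
have [->|[x xS]] := set_0Vmem S; first by constructor.
have [y yS /and3P [_ _ gxy]] := mx_mate mS xS; have gyx : g y x by rewrite gS.
have nxy : x != y by apply: contraTneq gxy => ->; rewrite gI.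
have sub : [set x; y] \subset S by rewrite subUset !sub1set xS.
have [E|/set0Pn [z]] := eqVneq (S :\: [set x; y]) set0.
  have -> : S = [set x; y] by apply/eqP; rewrite eqEsubset sub andbT -setD_eq0 E.
  by constructor 3; rewrite cards2 nxy.
rewrite !inE negb_or => /andP [/andP [zx zy] zS].
have [u uS /and3P [_ _ gzu]] := mx_mate mS zS; have guz : g u z by rewrite gS.
have nzu : z != u by apply: contraTneq gzu => ->; rewrite gI.
have ux : u != x.
  by apply: contraNneq zy => E; rewrite E in guz; rewrite (mx_mate_uniq mS xS zS yS).
have uy : u != y.
  by apply: contraNneq zx => E; rewrite E in guz; rewrite (mx_mate_uniq mS yS zS xS).
constructor 2; apply/eqP; rewrite eqEcard SD D4.
have sub' : x |: (y |: [set z; u]) \subset S by rewrite !subUset !sub1set xS yS zS uS.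
apply: leq_trans (subset_leq_card sub').
by rewrite !cardsU1 !inE cards1 !negb_or nxy nzu ![x == _]eq_sym ![y == _]eq_sym zx zy ux uy.
Qed.

(** If the empty set is maximal or all of [D] is 1-regular, there is no other maximal set. Otherwise
    the maximal sets are pairs, at most 6 = C(4, 2) of them; when 6 occur, every pair is one and
    hence an edge. *)
Lemma nmx_order4 D : #|D| = 4 ->
  nmx D <= 6 /\ (nmx D = 6 -> {in D &, forall x y, x != y -> g x y}).
Proof.
move=> D4.
have small : nmx D <= 1 -> nmx D <= 6 /\ (nmx D = 6 -> {in D &, forall x y, x != y -> g x y}).
  by move=> H; split=> [|E]; [apply: leq_trans H _ | rewrite E in H].
case m0 : (mx D set0).
  apply: small; apply: (@mx_uniq_le1 _ set0) => S /mxP [rS SD _].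
  by have /mxP [_ _ H] := m0; apply: H; rewrite ?sub0set.
case rD : (reg1 D).
  apply: small; apply: (@mx_uniq_le1 _ D) => S /mxP [rS SD H].
  by apply/esym/H.
have sub : [set S | mx D S] \subset [set S : {set T} | S \subset D & #|S| == 2].
  apply/subsetP => S; rewrite !inE => mS; have /mxP [rS SD _] := mS.
  rewrite SD /=; case: (mx_order4 D4 mS) => [E|E|->//].
    by rewrite -E mS in m0.
  by rewrite -E rS in rD.
have := subset_leq_card sub; rewrite cards_draws D4 => le6; split=> // E6 x y xD yD nxy.
apply: contraT => ngxy.
have : [set x; y] \in [set S | mx D S].
  have /eqP -> : [set S | mx D S] == [set S : {set T} | S \subset D & #|S| == 2].
    by rewrite eqEcard sub cards_draws D4 -/(nmx D) E6.
  by rewrite inE subUset !sub1set xD yD cards2 nxy.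
rewrite inE => mxy; have [|z] := mx_mate mxy (x := x); first by rewrite !inE eqxx.
by rewrite !inE => /orP [] /eqP -> /and3P [_ _]; rewrite ?gI // (negPf ngxy).
Qed.

Lemma nmx_clique K : {in K &, forall x y, x != y -> g x y} -> 'C(#|K|, 2) <= nmx K.
Proof.
move=> cK; rewrite -cards_draws; apply: subset_leq_card; apply/subsetP => S.
rewrite !inE => /andP [SK /cards2P [x [y [nxy ES]]]]; subst S.
have xK : x \in K by apply: (subsetP SK); rewrite !inE eqxx.
have yK : y \in K by apply: (subsetP SK); rewrite !inE eqxx orbT.
have gxy := cK x y xK yK nxy; have gyx : g y x by rewrite gS.
apply/mxP; split=> //.
  apply/reg1P => u; rewrite !inE => /orP [] /eqP ->; [exists y|exists x];
    rewrite !inE eqxx ?orbT; split=> // z; rewrite !inE => /orP [] /eqP -> //; by rewrite gI.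
move=> S' /reg1P r' S'K sub; apply/eqP; rewrite eqEsubset sub andbT.
have xS : x \in S' by apply: (subsetP sub); rewrite !inE eqxx.
have yS : y \in S' by apply: (subsetP sub); rewrite !inE eqxx orbT.
have [w [wS gxw H]] := r' x xS; apply/subsetP => z zS; rewrite !inE.
have [//|nzx] := eqVneq z x; apply/eqP; rewrite (H y) // (H z) //.
by apply: cK; rewrite ?(subsetP S'K) // eq_sym.
Qed.

(* [G[A]] is a disjoint union of cliques of sizes [s]: [c x] is the index of
   the clique of [x]. *)
Definition ext A (s : seq nat) := exists c : T -> nat,
  [/\ {in A, forall x, c x < size s},
      forall i, i < size s -> #|[set x in A | c x == i]| = nth 0 s i
    & {in A &, forall x y, g x y = (c x == c y) && (x != y)}].

(** Lists of sizes are compared literally, so the new clique may enter at any position: K_4 and K_6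
    go in front, K_5 at the end. *)
Lemma ext_add A K s1 s2 : K \subset A ->
  {in K & A, forall x y, g x y = (y \in K) && (x != y)} ->
  ext (A :\: K) (s1 ++ s2) -> ext A (s1 ++ #|K| :: s2).
Proof.
move=> KA HK [c [c1 c2 c3]].
(* [bump h] skips the value [h], which becomes the label of [K]. *)
pose h := size s1; exists (fun x => if x \in K then h else bump h (c x)).
have bh i : (bump h i == h) = false by rewrite eq_sym; apply/negbTE/neq_bump.
have bi : injective (bump h) by exact: can_inj (bumpK h).
split=> [x xA | i | x y xA yA].
- rewrite size_cat /= -/h; case: ifP => xK; first by rewrite addnS ltnS leq_addr.
  have := c1 x; rewrite !inE xK xA /= size_cat -/h => /(_ isT); rewrite /bump; lia.
- rewrite size_cat /= -/h => ilt; case: (eqVneq i h) => [->|nih].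
    rewrite nth_cat ltnn subnn /=; apply: eq_card => x; rewrite !inE.
    case: ifP => xK; rewrite ?bh ?andbF // eqxx andbT; exact: (subsetP KA).
  have [j Ej] : exists j, i = bump h j.
    by exists (unbump h i); rewrite unbumpK // inE.
  have -> : nth 0 (s1 ++ #|K| :: s2) i = nth 0 (s1 ++ s2) j.
    move: Ej; rewrite !nth_cat -/h /bump; case: (leqP h j) => hj ->.
      by rewrite add1n ltnNge (leqW hj) /= subSn.
    by rewrite add0n hj.
  rewrite -c2; last by rewrite size_cat -/h; move: Ej; rewrite /bump; lia.
  apply: eq_card => x; rewrite !inE Ej; case: ifP => xK; rewrite ?andbF /=.
    by rewrite eq_sym bh andbF.
  by rewrite (inj_eq bi).
- case xK: (x \in K); case yK : (y \in K).
  + by rewrite HK // yK eqxx.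
  + by rewrite HK // yK [h == _]eq_sym bh.
  + by rewrite gS HK // xK bh.
  + by rewrite (inj_eq bi) c3 // inE ?xK ?yK.
Qed.

(** Reads degrees off an extremal graph; this is how a tie for [A :\ v] constrains the neighbours of
    v. *)
Lemma ext_deg A s x : ext A s -> x \in A -> #|nb_in g A x|.+1 \in s.
Proof.
move=> [c [c1 c2 c3]] xA; have lt := c1 x xA.
rewrite (_ : #|nb_in g A x|.+1 = nth 0 s (c x)); first exact: mem_nth.
rewrite -c2 // [in RHS](cardsD1 x) !inE xA eqxx; congr _.+1; apply: eq_card => y;
  rewrite !inE /adj_in xA /=.
case yA : (y \in A); rewrite ?andbF //= c3 //.
by rewrite andbC eq_sym [c x == _]eq_sym.
Qed.

(** The class with label 0 is a clique and a union of components, so it splits off as a factor. The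
    reverse inequality is left to the general upper bound. *)
Lemma nmx_ext A s : ext A s -> \prod_(k <- s) 'C(k, 2) <= nmx A.
Proof.
elim: s A => [|k s IH] A; first by rewrite big_nil nmx_gt0.
move=> [c [c1 c2 c3]]; pose K := [set x in A | c x == 0].
have KA : K \subset A by apply/subsetP => x; rewrite inE => /andP [].
have cl : closed_in A K.
  split=> // x y; rewrite !inE => /andP [xA /eqP cx] /and3P [_ yA].
  by rewrite c3 // yA cx eq_sym => /andP [].
rewrite big_cons (nmx_comp cl); apply: leq_mul.
  rewrite -[k]/(nth 0 (k :: s) 0) -c2 //; apply: nmx_clique => x y.
  by rewrite !inE => /andP [xA /eqP cx] /andP [yA /eqP cy] nxy; rewrite c3 // cx cy.
apply: IH; exists (fun x => (c x).-1).
have AK x : x \in A :\: K -> x \in A /\ c x != 0.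
  by rewrite !inE => /andP [+ xA]; rewrite xA /=.
split=> [x /AK [xA cx]|i si|x y /AK [xA cx] /AK [yA cy]].
- by have := c1 x xA => /=; lia.
- rewrite -[RHS]/(nth 0 (k :: s) i.+1) -c2 //; apply: eq_card => x; rewrite !inE.
  by case: (x \in A) => //=; lia.
- by rewrite c3 //; congr (_ && _); lia.
Qed.

End Components.

(** * Matchings versus vertex sets, isomorphisms versus labellings *)

Section Encoding.
Variables (T : finType) (g : rel T).
Hypotheses (gS : symmetric g) (gI : irreflexive g).

Lemma is_edgeP (E : {set T}) : reflect (exists x y, g x y /\ E = [set x; y]) (is_edge g E).
Proof.
apply: (iffP existsP) => [[x /existsP [y /andP [/andP [_ gxy] /eqP ->]]]|[x [y [gxy ->]]]].
  by exists x, y.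
exists x; apply/existsP; exists y; rewrite gxy eqxx !andbT.
by apply: contraTneq gxy => ->; rewrite gI.
Qed.

Definition edges_in (S : {set T}) : {set {set T}} := [set E | is_edge g E & E \subset S].

(** 1-regularity gives each covered vertex a single neighbour in the cover, its partner in [M]; an
    edge inside the cover therefore already belongs to [M]. *)
Lemma edges_in_cover M : is_induced_matching g M -> reg1 g (cover M) /\ M = edges_in (cover M).
Proof.
move=> /andP [/andP [/forall_inP eM _] rM]; split=> //.
apply/setP => E; rewrite inE; apply/idP/andP => [EM|[/is_edgeP [x [y [gxy ->]]] sub]].
  by split; [exact: eM | exact: bigcup_sup].
have /reg1P H : reg1 g (cover M) := rM.
have /bigcupP [E1 E1M xE] : x \in cover M by apply: (subsetP sub); rewrite !inE eqxx.
have yM : y \in cover M by apply: (subsetP sub); rewrite !inE eqxx orbT.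
have xM : x \in cover M by apply: (subsetP sub); rewrite !inE eqxx.
have [z [_ _ Hz]] := H x xM.
have /is_edgeP [a [b [gab E1E]]] := eM _ E1M.
have sE1 : E1 \subset cover M by apply: bigcup_sup.
have aM : a \in cover M by apply: (subsetP sE1); rewrite E1E !inE eqxx.
have bM : b \in cover M by apply: (subsetP sE1); rewrite E1E !inE eqxx orbT.
have yz := Hz y yM gxy; move: xE; rewrite E1E !inE => /orP [] /eqP Ex; subst x.
  by rewrite yz -(Hz b bM gab) -E1E.
by rewrite yz -(Hz a aM _) 1?gS // setUC -E1E.
Qed.

Lemma cover_edges_in S : reg1 g S -> is_induced_matching g (edges_in S) /\ cover (edges_in S) = S.
Proof.
move=> rS; have /reg1P H := rS.
have E : cover (edges_in S) = S.
  apply/setP => x; apply/bigcupP/idP => [[E]|xS].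
    by rewrite inE => /andP [_ /subsetP sub]; apply: sub.
  have [y [yS gxy _]] := H x xS; exists [set x; y]; last by rewrite !inE eqxx.
  by rewrite inE subUset !sub1set xS yS !andbT; apply/is_edgeP; exists x, y.
split=> //; rewrite /is_induced_matching E andbC; apply/andP; split; first exact: rS.
apply/andP; split; first by apply/forall_inP => e; rewrite inE => /andP [].
apply/forall_inP => E1; rewrite inE => /andP [/is_edgeP [a [b [gab ->]]]].
rewrite subUset !sub1set => /andP [aS bS].
apply/forall_inP => E2; rewrite inE => /andP [/is_edgeP [c [d [gcd ->]]]].
rewrite subUset !sub1set => /andP [cS dS]; apply/implyP; apply: contraR.
have gba : g b a by rewrite gS. have gdc : g d c by rewrite gS.
have U x y z : x \in S -> y \in S -> z \in S -> g x y -> g x z -> y = z.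
  by move=> xS yS zS gxy gxz; have [w [_ _ Hw]] := H x xS; rewrite (Hw y) // (Hw z).
rewrite -setI_eq0 => /set0Pn [x]; rewrite !inE => /andP [/orP [] /eqP -> /orP [] /eqP E'].
- by rewrite -E' in gcd *; rewrite (U a b d).
- by rewrite -E' in gdc *; rewrite (U a b c) // setUC.
- by rewrite -E' in gcd *; rewrite (U b a d) // setUC.
- by rewrite -E' in gdc *; rewrite (U b a c) // setUC.
Qed.

(** [cover] and [edges_in] are mutually inverse and monotone, hence carry maximal matchings to
    maximal vertex sets and back. *)
Lemma num_max_induced_matchingsE : num_max_induced_matchings g = num_mx g setT.
Proof.
rewrite /num_max_induced_matchings /num_mx
  -(card_in_imset (f := edges_in) (D := [set S | mx g setT S])).
  have covS (M M' : {set {set T}}) : M \subset M' -> cover M \subset cover M'.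
    by move=> /subsetP s; apply/bigcupsP => E /s; apply: bigcup_sup.
  have edS (S S' : {set T}) : S \subset S' -> edges_in S \subset edges_in S'.
    move=> s; apply/subsetP => E; rewrite !inE => /andP [-> /subset_trans] /=; exact.
  apply: eq_card => M; rewrite inE; apply/andP/imsetP.
    move=> [iM /forallP maxM]; have [rM EM] := edges_in_cover iM.
    exists (cover M) => //; rewrite inE; apply/mxP; split; rewrite ?subsetT // => S' r' _ sub.
    have [iS' cS'] := cover_edges_in r'.
    have : ~~ (M \proper edges_in S').
      by apply: contraL iS'; apply: implyP.
    rewrite properE {1}EM edS //= negbK => s2.
    apply/eqP; rewrite eqEsubset sub andbT -cS'; exact: covS.
  move=> [S]; rewrite inE => /mxP [rS _ maxS] ->; have [iS cS] := cover_edges_in rS; split=> //.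
  apply/forallP => M'; apply/implyP => pr; apply/negP => iM'.
  have [r' E'] := edges_in_cover iM'.
  have EE : cover M' = S by apply: maxS => //; rewrite -cS; apply/covS/proper_sub.
  by move: pr; rewrite E' EE properxx.
move=> S1 S2; rewrite !inE => /mxP [r1 _ _] /mxP [r2 _ _] E.
by rewrite -(cover_edges_in r1).2 E (cover_edges_in r2).2.
Qed.

Lemma iso_ext s : graph_iso g (@cliques_rel s) -> ext g setT s.
Proof.
move=> [f [bf gf]]; exists (fun x => tag (f x) : nat); have fi := bij_inj bf.
split=> [x _|i si|x y _ _].
- exact: ltn_ord.
- rewrite -[RHS]card_ord; pose i0 := Ordinal si.
  pose t := fun j : 'I_(nth 0 s i0) => Tagged (fun i : 'I_(size s) => 'I_(nth 0 s i)) j.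
  rewrite -(card_imset _ fi) -(card_imset predT (f := t)).
    apply: eq_card => u; apply/imsetP/imsetP.
      move=> [x]; rewrite !inE /= => /eqP E ->.
      case: (f x) E => j k /= E; have Ej : j = i0 by apply: ord_inj.
      by subst j; exists k.
    move=> [k _ ->]; have [f' _ f'K] := bf; exists (f' (t k)); last by rewrite f'K.
    by rewrite !inE f'K /= eqxx.
  by move=> j k /eqP; rewrite eq_Tagged => /eqP.
- by rewrite gf /cliques_rel (inj_eq fi).
Qed.

Lemma ext_iso s : ext g setT s -> graph_iso g (@cliques_rel s).
Proof.
move=> [c [c1 c2 c3]].
have cx x : c x < size s by apply: c1; rewrite inE.
pose C i := [set x in [set: T] | c x == i].
(* A vertex is sent to its rank within its own class. *)
have rx x : index x (enum (C (c x))) < nth 0 s (c x).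
  by rewrite -c2 // cardE index_mem mem_enum !inE eqxx.
pose f x : cliques_vtx s := @Tagged _ (Ordinal (cx x))
  (fun i : 'I_(size s) => 'I_(nth 0 s i)) (Ordinal (rx x)).
have fi : injective f.
  move=> x y E; have Et : c x = c y := congr1 (fun u : cliques_vtx s => tag u : nat) E.
  have := congr1 (fun u : cliques_vtx s => tagged u : nat) E; rewrite /= Et.
  by apply: (index_inj x); rewrite mem_enum !inE ?Et eqxx.
exists f; split; last by move=> x y; rewrite c3 ?inE // /cliques_rel (inj_eq fi).
(* An injection is bijective once its target is no larger than its source; summing the class sizes
   shows this. *)
apply: inj_card_bij => //; rewrite card_tagged sumnE big_map big_enum /=.
rewrite (eq_bigr (fun i : 'I_(size s) => \sum_(x | c x == i) 1)) => [|i _]; last first.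
  by rewrite card_ord sum1_card -c2 //; apply: eq_card => x; rewrite !inE.
rewrite -sum1_card (partition_big (fun x => Ordinal (cx x)) predT) //=.
Qed.

End Encoding.

(** * The induction step *)

Section Induction.
Variables (T : finType) (g : rel T).
Hypotheses (gS : symmetric g) (gI : irreflexive g).

(** The converse of the second half is [nmx_ext]. At orders 1, 2, 3, 7 the list [extremal_sizes]
    does not even sum to the order, but that half is vacuous there, since 20 does not divide [Q]. *)
Definition good (A : {set T}) : Prop :=
  20 * num_mx g A <= Q #|A| /\ (20 * num_mx g A = Q #|A| -> ext g A (extremal_sizes #|A|)).

Lemma good_lt A : 20 * num_mx g A < Q #|A| -> good A.
Proof. by move=> lt; split=> [|E]; [exact: ltnW | rewrite E ltnn in lt]. Qed.

Variable A : {set T}.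
Hypothesis IH : forall B : {set T}, #|B| < #|A| -> good B.

Local Notation n := #|A|.
Local Notation nmx := (num_mx g).
Local Notation adj := (adj_in g A).
Local Notation nb := (nb_in g A).
Local Notation cl := (cl_in g A).
Local Notation deg x := #|nb x|.

Lemma adj_sym x y : adj x y = adj y x.
Proof. exact: adjS. Qed.

Lemma adj_irr x : adj x x = false.
Proof. exact: adjI. Qed.

Lemma adjA x y : adj x y -> x \in A.
Proof. by case/and3P. Qed.

Lemma nmx_setD R k : 0 < k -> k <= #|A :&: R| -> 20 * nmx (A :\: R) <= Q (n - k).
Proof.
move=> k0 kR; have E := cardsID R A.
have [|H _] := IH (B := A :\: R); first by lia.
by apply: leq_trans H _; apply: Q_le; lia.
Qed.

Lemma nmx_setD1 v : v \in A -> 20 * nmx (A :\ v) <= Q (n - 1).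
Proof.
move=> vA; apply: nmx_setD => //; rewrite card_gt0; apply/set0Pn; exists v.
by rewrite !inE vA eqxx.
Qed.

Lemma ext_add_clique K s1 s2 : closed_in g A K -> {in K &, forall x y, x != y -> g x y} ->
  ext g (A :\: K) (s1 ++ s2) -> ext g A (s1 ++ #|K| :: s2).
Proof.
move=> [KA Kc] cK; apply: ext_add => // x y xK yA.
case yK : (y \in K) => /=.
  by have [->|/(cK _ _ xK yK) //] := eqVneq x y; rewrite gI.
apply: contraFF yK => gxy; apply: (Kc x) => //.
by rewrite /adj_in yA gxy (subsetP KA).
Qed.

(** Counts multiply over components. A factor below 6 on [D] would lose strictly, so a tie makes [D]
    a K_4 and the rest extremal. *)
Lemma good_order4 D : closed_in g A D -> #|D| = 4 -> good A.
Proof.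
move=> cD D4; have [DA _] := cD; have nD : #|A :\: D| = n - 4.
  by rewrite cardsD (setIidPr DA) D4.
have n4 : 4 <= n by rewrite -D4; exact: subset_leq_card.
have [le6 eq6] := nmx_order4 gS gI D4.
have [|B1 B2] := IH (B := A :\: D); first by lia.
have E := nmx_comp gS cD; rewrite nD in B1 B2; have Q4 := Q_sub_comp4 n4.
have P0 := nmx_gt0 g (A :\: D).
split; first by rewrite E; nia.
rewrite E => EQ; have N6 : nmx D = 6 by nia.
rewrite N6 in EQ; rewrite sizes_cons4 //; last lia.
have -> : 4 :: extremal_sizes (n - 4) = [::] ++ #|D| :: extremal_sizes (n - 4) by rewrite D4.
by apply: ext_add_clique => //=; [exact: eq6 | apply: B2; lia].
Qed.

(** * Closed neighbourhoods; vertices of degree 0, 1, 4 and at least 5 *)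

Definition cnb v := v |: nb v.

Lemma cnb_sub v : v \in A -> cnb v \subset A.
Proof.
move=> vA; apply/subsetP => x; rewrite !inE => /orP [/eqP -> //|].
by rewrite adj_sym => /adjA.
Qed.

Lemma card_cnb v : #|cnb v| = (deg v).+1.
Proof. by rewrite cardsU1 inE adj_irr. Qed.

Lemma cnb_cl v w : adj v w -> cnb v \subset A :&: cl v w.
Proof.
move=> vw; have vA := adjA vw; rewrite subsetI cnb_sub //=.
by apply/subsetP => x; rewrite !inE => /orP [] ->; rewrite ?orbT.
Qed.

Lemma card_cl v w : adj v w -> (deg v).+1 <= #|A :&: cl v w|.
Proof. by move=> vw; rewrite -card_cnb; apply/subset_leq_card/cnb_cl. Qed.

(** A neighbour of w outside N[v] is one more vertex removed together with the edge vw; this gain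
    decides whether branching at v can be tight. *)
Lemma card_cl_open v w : adj v w -> ~~ (nb w \subset cnb v) -> (deg v).+2 <= #|A :&: cl v w|.
Proof.
move=> vw /subsetPn [x]; rewrite inE => wx nx; rewrite -card_cnb; apply: proper_card.
rewrite properE cnb_cl //=; apply/subsetPn; exists x => //; rewrite !inE wx !orbT andbT.
by move: wx; rewrite adj_sym => /adjA.
Qed.

Lemma cl_closed v w : adj v w -> nb w \subset cnb v -> cl v w = cnb v.
Proof.
move=> vw /subsetP cw; apply/setP => x; rewrite !inE.
apply/idP/idP => [/or4P [->|/eqP->|->|wx]|/orP [] ->]; rewrite ?orbT ?vw ?orbT //.
by have := cw x; rewrite !inE; apply.
Qed.

Lemma closed_cnb v : v \in A -> (forall w, w \in nb v -> nb w \subset cnb v) ->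
  closed_in g A (cnb v).
Proof.
move=> vA H; split; first exact: cnb_sub.
move=> x y; rewrite !inE => /orP [/eqP -> ->|vx xy]; first by rewrite orbT.
have xN : x \in nb v by rewrite inE.
by have := subsetP (H x xN) y; rewrite !inE; apply.
Qed.

Lemma nmx_vertex20 v : 20 * nmx A <= 20 * nmx (A :\ v) + \sum_(w in nb v) 20 * nmx (A :\: cl v w).
Proof. by rewrite -big_distrr -mulnDr leq_mul2l nmx_vertex. Qed.

Lemma sum_nmx_le (X : {set T}) v k : X \subset nb v -> 0 < k ->
  (forall w, w \in X -> k <= #|A :&: cl v w|) ->
  \sum_(w in X) 20 * nmx (A :\: cl v w) <= #|X| * Q (n - k).
Proof.
move=> XN k0 H; rewrite -sum_nat_const; apply: leq_sum => w wX.
exact/nmx_setD/H.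
Qed.

Lemma sum_nmx_deg v : \sum_(w in nb v) 20 * nmx (A :\: cl v w) <= deg v * Q (n - (deg v).+1).
Proof. by apply: sum_nmx_le => // w; rewrite inE => /card_cl. Qed.

Lemma sum_nmx_open1 v w1 : adj v w1 -> ~~ (nb w1 \subset cnb v) ->
  \sum_(w in nb v) 20 * nmx (A :\: cl v w)
  <= Q (n - (deg v).+2) + (deg v).-1 * Q (n - (deg v).+1).
Proof.
move=> vw o1; have w1N : w1 \in nb v by rewrite inE.
rewrite (big_setD1 w1) //=; apply: leq_add; first exact/nmx_setD/card_cl_open.
rewrite (cardsD1 w1) w1N /=; apply: sum_nmx_le => //; first exact: subD1set.
by move=> w /setD1P [_]; rewrite inE => /card_cl; rewrite (cardsD1 w1) w1N.
Qed.

Lemma sum_nmx_open2 v w1 w2 : adj v w1 -> adj v w2 -> w1 != w2 ->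
  ~~ (nb w1 \subset cnb v) -> ~~ (nb w2 \subset cnb v) ->
  \sum_(w in nb v) 20 * nmx (A :\: cl v w)
  <= 2 * Q (n - (deg v).+2) + (deg v).-2 * Q (n - (deg v).+1).
Proof.
move=> vw1 vw2 n12 o1 o2; have w1N : w1 \in nb v by rewrite inE.
have w2N : w2 \in nb v :\ w1 by rewrite !inE eq_sym n12.
rewrite (big_setD1 w1) //= (big_setD1 w2) //= addnA mul2n -addnn; apply: leq_add.
  by apply: leq_add; apply/nmx_setD/card_cl_open.
have Ed : deg v = #|nb v :\ w1 :\ w2|.+2.
  by rewrite (cardsD1 w1) w1N (cardsD1 w2 (_ :\ _)) w2N.
rewrite [X in X.-2]Ed /=; apply: sum_nmx_le => //.
  by apply: subset_trans (subD1set _ _) (subD1set _ _).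
by move=> w /setD1P [_ /setD1P [_]]; rewrite inE => /card_cl.
Qed.

Lemma deg_lt v : v \in A -> deg v < n.
Proof. by move=> vA; rewrite -card_cnb; apply/subset_leq_card/cnb_sub. Qed.

Lemma card_setD1 v : v \in A -> #|A :\ v| = n - 1.
Proof. by move=> vA; rewrite (cardsD1 v A) vA; lia. Qed.

Lemma deg_setD1 v w : adj v w -> #|nb_in g (A :\ v) w|.+1 = deg w.
Proof.
move=> vw; have wv : w != v by rewrite eq_sym (adj_neq gI vw).
rewrite [RHS](cardsD1 v) inE adj_sym vw; congr _.+1; apply: eq_card => x.
rewrite !inE /adj_in !inE wv /=.
by case: (x == v); rewrite /= ?andbF.
Qed.

Lemma sub_closed v : v \in A -> (forall w, w \in nb v -> nb w \subset cnb v) ->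
  \sum_(w in nb v) 20 * nmx (A :\: cl v w) = deg v * (20 * nmx (A :\: cnb v)).
Proof.
move=> vA H; rewrite -sum_nat_const; apply: eq_bigr => w wN.
by rewrite cl_closed ?H // -inE.
Qed.

(** A tie needs degree 5 and N[v] closed. Then [A :\ v] is extremal with cliques of order at least
    5, so every neighbour of v has degree at least 5 within the six vertices of N[v], which is a
    K_6. *)
Lemma good_deg_ge5 v : v \in A -> 5 <= deg v -> good A.
Proof.
move=> vA d5; have B := nmx_vertex20 v; have Bv := nmx_setD1 vA; have dn := deg_lt vA.
have [d6|d5'] := ltnP 5 (deg v).
  have Bs := sum_nmx_deg v; have q := @Q_sub_branch6 n (deg v).
  by apply: good_lt; lia.
have {d5 d5'} Ed : deg v = 5 by lia.
have n6 : 6 <= n by lia.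
have q := Q_sub_branch5 n6.
have [/existsP [w /andP [wN ow]]|] := boolP [exists w, (w \in nb v) && ~~ (nb w \subset cnb v)].
  move: wN; rewrite inE => vw; have Bs := sum_nmx_open1 vw ow; rewrite Ed /= in Bs.
  have n7 : 7 <= n.
    have := card_cl_open vw ow; rewrite Ed => /leq_trans; apply.
    exact/subset_leq_card/subsetIl.
  have : Q (n - 7) < Q (n - 6) by rewrite (_ : n - 6 = (n - 7).+1) ?Q_ltS; lia.
  by move=> ?; apply: good_lt; lia.
rewrite negb_exists => /forallP H.
have {}H w : w \in nb v -> nb w \subset cnb v.
  by move=> wN; have := H w; rewrite wN /= negbK.
rewrite sub_closed // Ed in B.
have [KA Kc] := closed_cnb vA H; have cK := card_cnb v; rewrite Ed in cK.
have nK : #|A :\: cnb v| = n - 6 by rewrite cardsD (setIidPr KA) cK.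
have [|BK1 BK2] := IH (B := A :\: cnb v); first by lia.
have [|Bv1 Bv2] := IH (B := A :\ v); first by rewrite card_setD1 //; lia.
rewrite nK in BK1 BK2; rewrite card_setD1 // in Bv1 Bv2.
split; first by lia.
move=> E; have eqv : 20 * nmx (A :\ v) = Q (n - 1) by lia.
have eqK : 20 * nmx (A :\: cnb v) = Q (n - 6) by lia.
have eqQ : Q (n - 1) + 5 * Q (n - 6) = Q n by lia.
have -> : extremal_sizes n = [::] ++ #|cnb v| :: extremal_sizes (n - 6).
  by rewrite cK sizes_cons6.
apply: ext_add_clique => //=; last exact: BK2.
have dw w : w \in nb v -> 5 <= deg w.
  move=> wN; have vw : adj v w by move: wN; rewrite inE.
  rewrite -(deg_setD1 vw); have wA : w \in A :\ v.
    rewrite !inE eq_sym (adj_neq gI vw); by move: vw; rewrite adj_sym => /adjA.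
  exact: (allP (sizes_ge5 n6 (or_introl eqQ)) _ (ext_deg (Bv2 eqv) wA)).
have main x y : x \in nb v -> y \in cnb v -> x != y -> g x y.
  move=> xN yK xy; have sub : nb x \subset cnb v :\ x.
    by rewrite subsetD1 H // inE adj_irr.
  have : #|cnb v :\ x| <= deg x.
    have := dw x xN; have := cardsD1 x (cnb v); rewrite cK in_setU1 xN orbT; lia.
  move=> le; have /eqP E' : nb x == cnb v :\ x by rewrite eqEcard sub.
  have : y \in nb x by rewrite E' !inE eq_sym xy; move: yK; rewrite !inE.
  by rewrite inE => /and3P [].
move=> x y xK yK xy; move: (xK) (yK); rewrite !in_setU1 => /orP [/eqP Ex|xN];
  last by move=> _; apply: main.
move=> /orP [/eqP Ey|yN]; first by rewrite Ex Ey eqxx in xy.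
by rewrite gS; apply: main; rewrite 1?eq_sym.
Qed.

Lemma good_deg0 v : v \in A -> deg v = 0 -> good A.
Proof.
move=> vA d0; have := sum_nmx_deg v; rewrite d0 mul0n => Bs.
have B := nmx_vertex20 v; have Bv := nmx_setD1 vA.
have := deg_lt vA; rewrite d0 => n0.
have : Q (n - 1) < Q n by rewrite -{2}(prednK n0) -subn1 Q_ltS.
by move=> ?; apply: good_lt; lia.
Qed.

(** Branching at the neighbour u of the leaf pays: without u the leaf is isolated and can be deleted
    as well, so the first term drops to order n - 2. *)
Lemma good_deg1 v : (forall x, x \in A -> deg x <= 4) -> v \in A -> deg v = 1 -> good A.
Proof.
move=> d4 vA d1; have /cards1P [u Eu] : deg v == 1 by rewrite d1.
have vu : adj v u by rewrite -[adj v u]in_set -/(nb v) Eu set11.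
have uv : adj u v by rewrite adj_sym.
have uA := adjA uv; have uD4 := d4 u uA.
have nuv := adj_neq gI uv.
have B := nmx_vertex20 u; have Bs := sum_nmx_deg u; have un := deg_lt uA.
have du : 0 < deg u by rewrite card_gt0; apply/set0Pn; exists v; rewrite inE.
have Bu : 20 * nmx (A :\ u) <= Q (n - 2).
  have lone : nb_in g (A :\ u) v = set0.
    apply/setP => x; rewrite !inE; apply/negP => /and3P [_ /setD1P [xu xA] gvx].
    have : x \in nb v by rewrite inE /adj_in vA xA.
    by rewrite Eu inE (negPf xu).
  have := nmx_vertex gS gI (A :\ u) v; rewrite lone big_set0 addn0 => le.
  have E : A :\ u :\ v = A :\: [set u; v] by rewrite setDDl.
  apply: (leq_trans (n := 20 * nmx (A :\ u :\ v))); first by rewrite leq_mul2l le.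
  rewrite E; apply: nmx_setD => //; rewrite (setIidPr _) ?cards2 ?nuv //.
  by rewrite subUset !sub1set uA vA.
apply: good_lt; apply: leq_ltn_trans (leq_trans B (leq_add Bu Bs)) _.
by apply: Q_sub_leaf; rewrite ?du.
Qed.

Lemma good_deg4 v : (forall x, x \in A -> 2 <= deg x <= 4) -> v \in A -> deg v = 4 -> good A.
Proof.
move=> d24 vA Ed; have B := nmx_vertex20 v; have Bv := nmx_setD1 vA.
have dn := deg_lt vA; have cK := card_cnb v; rewrite Ed in dn cK.
have KA := cnb_sub vA.
have nK : #|A :\: cnb v| = n - 5 by rewrite cardsD (setIidPr KA) cK.
have [|BK1 BK2] := IH (B := A :\: cnb v); first by lia.
rewrite nK in BK1 BK2.
have vN : v \notin nb v by rewrite inE adj_irr.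
have DK : A :\ v :\: nb v = A :\: cnb v by rewrite setDDl.
(* If exactly one neighbour [w] of [v] has a neighbour outside [N[v]], then
   deleting [w] cuts off the other four vertices of [N[v]].  With two such
   neighbours the bound at [v] is attained only if [A - v] is extremal, whose
   degrees are then too large. *)
pose W := [set w in nb v | ~~ (nb w \subset cnb v)].
have [W0|[w wW]] := set_0Vmem W.
  have H w : w \in nb v -> nb w \subset cnb v.
    by move=> wN; apply: contraT => ow; rewrite -(in_set0 w) -W0 inE wN.
  rewrite sub_closed // Ed in B.
  (* N(v) splits off from [A :\ v] with at most 6 maximal sets, and the edges at v add 4: together
     the factor 10 between [Q (n - 5)] and [Q n]. *)
  have cN : closed_in g (A :\ v) (nb v).
    split; first by rewrite subsetD1 vN andbT; apply: subset_trans KA; apply: subsetUr.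
    move=> x y xN /and3P [/setD1P [_ xA] /setD1P [yv yA] gxy].
    have := subsetP (H x xN) y; rewrite !inE (negPf yv) /=; apply.
    by rewrite /adj_in xA yA.
  have [le6 eq6] := nmx_order4 gS gI Ed.
  have E := nmx_comp gS cN; rewrite DK in E.
  have P0 := nmx_gt0 g (A :\: cnb v).
  have Q5 : Q n = 10 * Q (n - 5) by rewrite -Q_add5; congr Q; lia.
  split; first by rewrite Q5; nia.
  move=> EQ; have EK : 20 * nmx (A :\: cnb v) = Q (n - 5) by nia.
  have N6 : nmx (nb v) = 6 by nia.
  have -> : extremal_sizes n = extremal_sizes (n - 5) ++ #|cnb v| :: [::].
    rewrite cK cats1 -sizes_rcons5 ?subnK //; by rewrite -EK dvdn_mulr.
  apply: ext_add_clique; last by rewrite cats0; apply: BK2.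
    exact: closed_cnb.
  move=> x y; rewrite !in_setU1 => /orP [/eqP Ex|xN] /orP [/eqP Ey|yN] xy.
  - by rewrite Ex Ey eqxx in xy.
  - by move: yN; rewrite Ex inE => /and3P [].
  - by move: xN; rewrite gS Ey inE => /and3P [].
  - exact: eq6.
have : w \in W := wW; rewrite inE => /andP [wN ow].
have vw : adj v w by move: wN; rewrite inE.
have wv : adj w v by rewrite adj_sym.
have wA := adjA wv.
have n6 : 6 <= n.
  have := card_cl_open vw ow; rewrite Ed => /leq_trans; apply.
  exact/subset_leq_card/subsetIl.
have [W1|[w2]] := set_0Vmem (W :\ w); last first.
  rewrite !inE => /andP [n2 /andP [vw2 ow2]]; rewrite eq_sym in n2.
  have Bs := sum_nmx_open2 vw vw2 n2 ow ow2; rewrite Ed /= in Bs.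
  have q := Q_sub_branch4 n6.
  have [|Bv1 Bv2] := IH (B := A :\ v); first by rewrite card_setD1 //; clear -dn; lia.
  rewrite card_setD1 // in Bv1 Bv2.
  split; first by clear -B Bs q Bv1; lia.
  move=> EQ; have /Bv2 X : 20 * nmx (A :\ v) = Q (n - 1) by clear -EQ B Bs q Bv1; lia.
  have a5 : all (leq 5) (extremal_sizes (n - 1)).
    apply: sizes_ge5 => //; right; apply/eqP; rewrite eqn_leq q /=; clear -EQ B Bs Bv1; lia.
  have wA' : w \in A :\ v by rewrite !inE wA andbT eq_sym (adj_neq gI vw).
  have := allP a5 _ (ext_deg X wA'); rewrite (deg_setD1 vw).
  by have := d24 w wA; clear; lia.
have wK : w \in cnb v by rewrite in_setU1 wN orbT.
have cD : closed_in g (A :\ w) (cnb v :\ w).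
  split; first exact: setSD.
  move=> x y; rewrite !in_setD1 => /andP [xw xK] /and3P [_ /setD1P [yw yA] gxy].
  rewrite yw /=; have xA := subsetP KA x xK.
  have xy : adj x y by rewrite /adj_in xA yA.
  move: xK; rewrite in_setU1 => /orP [/eqP Ex|xN].
    by rewrite in_setU1 inE -Ex xy orbT.
  have := in_set0 x; rewrite -W1 in_setD1 xw inE xN /= => /negbFE /subsetP; apply.
  by rewrite inE.
have D4 : #|cnb v :\ w| = 4 by have := cardsD1 w (cnb v); rewrite cK wK; clear; lia.
have [le6 _] := nmx_order4 gS gI D4.
have E := nmx_comp gS cD.
have DD : A :\ w :\: (cnb v :\ w) = A :\: cnb v.
  apply/setP => x; rewrite !in_setD !in_set1; case: eqP => [->|_] //=.
  by rewrite wK.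
rewrite DD in E; have {}B := nmx_vertex20 w.
have Bw : 20 * nmx (A :\ w) <= 6 * Q (n - 5) by clear -E le6 BK1; nia.
(* Among the edges at w, the edge wv removes at least 6 vertices: the five of N[v] and a neighbour
   of w outside it. *)
have Bs : \sum_(y in nb w) 20 * nmx (A :\: cl w y) <= Q (n - 6) + (deg w).-1 * Q (n - (deg w).+1).
  have vNw : v \in nb w by rewrite inE.
  rewrite (big_setD1 v) //=; apply: leq_add.
    apply: nmx_setD => //.
    have -> : cl w v = cl v w.
      by apply/setP => x; rewrite !inE orbCA; congr (_ || (_ || _)); apply: orbC.
    by have := card_cl_open vw ow; rewrite Ed.
  rewrite (cardsD1 v) vNw /=; apply: sum_nmx_le => //; first exact: subD1set.
  by move=> x /setD1P [_]; rewrite inE => /card_cl; rewrite (cardsD1 v) vNw.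
apply: good_lt; apply: leq_ltn_trans (leq_trans B (leq_add Bw Bs)) _.
exact: Q_sub_cut (d24 w wA) n6.
Qed.

(* [(x, y, ws)]: an edge [xy] with distinct vertices [ws] of [N[x]] and [N[y]],
   so that branching on [xy] leaves at most [n - size ws] vertices. *)
Definition edge_witness (p : T * T * seq T) : bool :=
  [&& adj p.1.1 p.1.2, uniq p.2, 0 < size p.2
    & all (fun z => [|| z == p.1.1, z == p.1.2, adj p.1.1 z | adj p.1.2 z]) p.2].

Definition lists_edge (L : seq (T * T * seq T)) (a b : T) : bool :=
  has (fun p => (p.1.1 == a) && (p.1.2 == b) || (p.1.1 == b) && (p.1.2 == a)) L.

Definition weight (L : seq (T * T * seq T)) : nat := \sum_(p <- L) Q (n - size p.2).

Lemma size_sub (s : seq T) (B : {set T}) : uniq s -> {subset s <= B} -> size s <= #|B|.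
Proof. by move=> us sB; rewrite -(card_uniqP us); apply/subset_leq_card/subsetP. Qed.

Lemma edge_witness_card p : edge_witness p -> size p.2 <= #|A :&: cl p.1.1 p.1.2|.
Proof.
case/and4P=> h us _ /allP H; apply: size_sub => // z /H; rewrite !inE => Hz; rewrite Hz andbT.
have yA : p.1.2 \in A by move: h; rewrite adj_sym => /adjA.
case/or4P: Hz => [/eqP->|/eqP->//|hz|hz]; first exact: adjA h.
  by move: hz; rewrite adj_sym => /adjA.
by move: hz; rewrite adj_sym => /adjA.
Qed.

Lemma edge_witness_size p : edge_witness p -> size p.2 <= n.
Proof. by move/edge_witness_card/leq_trans; apply; apply/subset_leq_card/subsetIl. Qed.

(** A maximal set meeting N(v) contains an edge listed in [L]. One avoiding N(v) also avoids v,
    whose partner would lie there; it is counted by the first term or, when N[w] lies in N[v],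
    cannot exist because vw could be added. The boolean [c] serves both versions. *)
Lemma branch_aux v nv L (c : bool) : v \in A ->
  (forall z, adj v z = (z \in nv)) ->
  (forall a, a \in nv -> forall b, adj a b -> lists_edge L a b) ->
  all edge_witness L -> uniq (v :: nv) ->
  (c \/ exists2 w, w \in nv & forall z, adj w z -> z \in v :: nv) ->
  20 * nmx A <= c * Q (n - size (v :: nv)) + weight L.
Proof.
move=> vA Nv HE /allP okL unv Hc.
pose L' := [seq (p.1.1, p.1.2, cl p.1.1 p.1.2) | p <- L].
pose B := [set z in v :: nv].
have : nmx A <= c * nmx (A :\: B) + \sum_(p <- L') nmx (A :\: p.2).
  apply: nmx_branch => //.
    by move=> p /mapP [q /okL /and4P [h _ _ _] ->] /=; rewrite h subxx.
  move=> S mS; case: (boolP (has (mem S) nv)) => [/hasP [a aN aS]|/hasPn nS].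
    have [b bS h] := mx_mate mS aS; have /hasP [p pL Hp] := HE a aN b h.
    apply/orP; left; apply/hasP; exists (p.1.1, p.1.2, cl p.1.1 p.1.2).
      by apply/mapP; exists p.
    have /and4P [hp _ _ _] := okL p pL.
    have [xS yS] : p.1.1 \in S /\ p.1.2 \in S.
      by case/orP: Hp => /andP [/eqP -> /eqP ->].
    by rewrite /= xS yS mx_cl.
  have vS : v \notin S.
    apply/negP => vS; have [b bS h] := mx_mate mS vS.
    by have := nS b; rewrite -Nv h /= => /(_ isT) /negP; apply.
  have dis z : z \in v :: nv -> z \notin S.
    by rewrite inE => /orP [/eqP->//|/nS].
  case: Hc => [cT|[w wN Hw]]; apply/orP.
    right; rewrite cT disjoint_subset; apply/subsetP => z zS; rewrite !inE.
    by apply/negP => /dis; rewrite zS.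
  have vw : adj v w by rewrite Nv.
  have [z zS] := mx_block gS gI mS vw; rewrite inE => /or4P [/eqP E|/eqP E|h|h].
  - by rewrite -E zS in vS.
  - by have := dis w; rewrite inE wN orbT -E zS => /(_ isT).
  - by have := dis z; rewrite inE -Nv h orbT zS => /(_ isT).
  - by have := dis z (Hw z h); rewrite zS.
rewrite big_map /= -(leq_pmul2l (isT : 0 < 20)) => /leq_trans; apply.
rewrite mulnDr mulnCA big_distrr /=; apply: leq_add.
  rewrite leq_mul2l; apply/orP; right; apply: nmx_setD => //.
  apply: (@size_sub (v :: nv)) => // z; rewrite !inE => /orP [/eqP->|zN];
    rewrite ?vA ?eqxx // zN orbT andbT.
  by apply: (@adjA z v); rewrite adj_sym Nv.
rewrite /weight big_seq [leqRHS]big_seq; apply: leq_sum => p /okL ok.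
by apply: nmx_setD; [case/and4P: ok | exact: edge_witness_card].
Qed.

Lemma branch_nbhd v nv L : v \in A ->
  (forall z, adj v z = (z \in nv)) ->
  (forall a, a \in nv -> forall b, adj a b -> lists_edge L a b) ->
  all edge_witness L -> uniq (v :: nv) ->
  20 * nmx A <= Q (n - size (v :: nv)) + weight L.
Proof. by move=> *; rewrite -[X in X + _]mul1n; apply: (@branch_aux _ _ _ true) => //; left. Qed.

Lemma branch_closed v nv L w : v \in A ->
  (forall z, adj v z = (z \in nv)) ->
  (forall a, a \in nv -> forall b, adj a b -> lists_edge L a b) ->
  all edge_witness L -> uniq (v :: nv) ->
  w \in nv -> (forall z, adj w z -> z \in v :: nv) ->
  20 * nmx A <= weight L.
Proof. by move=> *; apply: (@branch_aux v nv L false) => //; right; exists w. Qed.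

(** The known neighbours come first; degree bounds then leave few lengths for the rest, and case
    analysis names each unknown neighbour. *)
Lemma nbrs x t : uniq t -> all (adj x) t -> exists s,
  [/\ uniq (t ++ s), size t + size s = deg x & forall z, adj x z = (z \in t ++ s)].
Proof.
move=> ut at_; exists [seq z <- enum (nb x) | z \notin t].
have uts : uniq (t ++ [seq z <- enum (nb x) | z \notin t]).
  rewrite cat_uniq ut filter_uniq ?enum_uniq // andbT; apply/hasPn => z.
  by rewrite mem_filter => /andP [].
have mts z : adj x z = (z \in t ++ [seq z <- enum (nb x) | z \notin t]).
  rewrite mem_cat mem_filter mem_enum inE; case zt: (z \in t) => //=.
  exact: (allP at_).
split=> //; rewrite -size_cat -(card_uniqP uts); apply: eq_card => z.
by rewrite [RHS]inE mts.
Qed.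

(** * Tactics for explicit configurations *)

Ltac destr_and := repeat match goal with H : is_true (_ && _) |- _ =>
  let h1 := fresh "neq" in let h2 := fresh "neq" in case/andP: H => h1 h2 end.

Ltac uniqs H := move: H; rewrite /= ?inE ?negb_or ?andbT; let U := fresh "U" in move=> U;
  destr_and.

Ltac decide_adj :=
  rewrite /edge_witness /=;
  repeat match goal with
  | H : forall z, adj_in _ _ ?x z = _ |- context [adj_in _ _ ?x ?y] => rewrite (H y)
  | H : is_true (adj_in ?g ?A ?x ?y) |- context [adj_in ?g ?A ?x ?y] => rewrite H
  end;
  rewrite ?inE ?negb_or ?eqxx ?orbT /=;
  repeat match goal with
  | H : is_true (?x != ?y) |- context [?x == ?y] => rewrite (negPf H)
  | H : is_true (?x != ?y) |- context [?y == ?x] => rewrite [y == x]eq_sym (negPf H)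
  end; rewrite ?orbT ?andbT //=.

Ltac cases_in := rewrite !inE; repeat (case/orP); move=> /eqP ->.

Ltac list_edges :=
  let p := fresh "p" in move=> p; cases_in; let z := fresh "z" in move=> z;
  match goal with H : forall z, adj_in _ _ ?x z = _ |- context [adj_in _ _ ?x _] => rewrite H end;
  cases_in; by rewrite /lists_edge /= !eqxx ?orbT.

Ltac list_closed :=
  let z := fresh "z" in move=> z;
  match goal with H : forall z, adj_in _ _ ?x z = _ |- context [adj_in _ _ ?x _] => rewrite H end;
  cases_in; by rewrite ?inE !eqxx ?orbT.

(** * Graphs of degrees 2 and 3 *)

Section Subcubic.
Hypothesis d23 : forall x, x \in A -> 2 <= deg x <= 3.

Lemma other_nb x y : adj x y -> exists2 z, adj x z & z != y.
Proof.
move=> xy; have [|s [us ss Ns]] := @nbrs x [:: y] isT; first by rewrite /= xy.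
have := d23 (adjA xy); rewrite -ss; case: s us {ss} Ns => // z s us Ns _.
by exists z; [rewrite Ns !inE eqxx orbT | uniqs us; decide_adj].
Qed.

Lemma good_diamond1 v a b c a' : uniq [:: v; a; b; c] -> uniq [:: v; b; a'] ->
  (forall z, adj v z = (z \in [:: a; b; c])) -> (forall z, adj b z = (z \in [:: v; a; c])) ->
  (forall z, adj a z = (z \in [:: v; b; a'])) -> (forall z, adj c z = (z \in [:: v; b])) ->
    good A.
Proof.
move=> ud u2 Nv Nb Na Nc; have ud' := ud; uniqs ud'; uniqs u2.
have vA : v \in A by apply: (@adjA v a); decide_adj.
have a'c : a' != c.
  have : ~~ adj c a by decide_adj.
  by apply: contra => /eqP <-; rewrite adj_sym; decide_adj.
have aa' : adj a a' by decide_adj.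
have a'a : adj a' a by rewrite adj_sym.
have na := adj_neq gI aa'.
have [x a'x xa] := other_nb a'a; have na'x := adj_neq gI a'x.
have xv : x != v by apply: contraTneq a'x => ->; rewrite adj_sym; decide_adj.
have xb : x != b by apply: contraTneq a'x => ->; rewrite adj_sym; decide_adj.
(* Only the three edges avoiding a settle for four vertices: va and ab also reach a', and aa' gets
   its fifth vertex x from the minimum degree 2. *)
pose L := [:: (v, a, [:: v; a; b; c; a']); (a, b, [:: v; a; b; c; a']);
             (v, b, [:: v; a; b; c]); (v, c, [:: v; a; b; c]); (b, c, [:: v; a; b; c]);
             (a, a', [:: a; v; b; a'; x])].
have okL : all edge_witness L by decide_adj.
have n5 : 5 <= n by have /andP [/edge_witness_size] := okL.
have : 20 * nmx A <= weight L.
  apply: (@branch_closed v [:: a; b; c] L b) => //;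
    [list_edges | by rewrite !inE eqxx orbT | list_closed].
rewrite /weight !big_cons big_nil /= => le; apply: good_lt; apply: leq_ltn_trans le _.
have := Q_sub_diamond1 n5; clear; lia.
Qed.

Lemma good_diamond2 v a b c a' c' : uniq [:: v; a; b; c] -> uniq [:: v; b; a'] ->
  uniq [:: v; b; c'] ->
  (forall z, adj v z = (z \in [:: a; b; c])) -> (forall z, adj b z = (z \in [:: v; a; c])) ->
  (forall z, adj a z = (z \in [:: v; b; a'])) -> (forall z, adj c z = (z \in [:: v; b; c'])) ->
  a' != c -> c' != a -> good A.
Proof.
move=> ud u2 u3 Nv Nb Na Nc a'c c'a; have ud' := ud; uniqs ud'; uniqs u2; uniqs u3.
have vA : v \in A by apply: (@adjA v a); decide_adj.
have aa' : adj a a' by decide_adj.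
have a'a : adj a' a by rewrite adj_sym.
have cc' : adj c c' by decide_adj.
have c'c : adj c' c by rewrite adj_sym.
have na := adj_neq gI aa'. have nc := adj_neq gI cc'.
have [x a'x xa] := other_nb a'a; have na'x := adj_neq gI a'x.
have xv : x != v by apply: contraTneq a'x => ->; rewrite adj_sym; decide_adj.
have xb : x != b by apply: contraTneq a'x => ->; rewrite adj_sym; decide_adj.
have [y c'y yc] := other_nb c'c; have nc'y := adj_neq gI c'y.
have yv : y != v by apply: contraTneq c'y => ->; rewrite adj_sym; decide_adj.
have yb : y != b by apply: contraTneq c'y => ->; rewrite adj_sym; decide_adj.
pose L := [:: (v, a, [:: v; a; b; c; a']); (a, b, [:: v; a; b; c; a']);
             (v, b, [:: v; a; b; c]); (v, c, [:: v; a; b; c; c']); (b, c, [:: v; a; b; c; c']);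
             (a, a', [:: a; v; b; a'; x]); (c, c', [:: c; v; b; c'; y])].
have okL : all edge_witness L by decide_adj.
have n5 : 5 <= n by have /andP [/edge_witness_size] := okL.
have : 20 * nmx A <= weight L.
  apply: (@branch_closed v [:: a; b; c] L b) => //;
    [list_edges | by rewrite !inE eqxx orbT | list_closed].
rewrite /weight !big_cons big_nil /= => le; apply: good_lt; apply: leq_ltn_trans le _.
have := Q_sub_diamond2 n5; clear; lia.
Qed.

(** Since N[v] = N[b], branching at v has no first term. The cases count how many of a, c have a
    neighbour outside the four vertices; if none does, these form a union of components and K_4 may
    occur. *)
Lemma good_diamond v a b c : uniq [:: v; a; b; c] ->
  (forall z, adj v z = (z \in [:: a; b; c])) ->
  (forall z, adj b z = (z \in [:: v; a; c])) -> good A.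
Proof.
move=> ud; have ud' := ud; uniqs ud' => Nv Nb.
have va : adj v a by decide_adj. have vb : adj v b by decide_adj. have vc : adj v c by decide_adj.
have av : adj a v by rewrite adj_sym. have cv : adj c v by rewrite adj_sym.
have ab : adj a b by rewrite adj_sym; decide_adj.
  have cb : adj c b by rewrite adj_sym; decide_adj.
have vA := adjA va; have aA := adjA av; have cA := adjA cv;
  have bA : b \in A by apply: (@adjA b a); decide_adj.
have D4 : #|[set z in [:: v; a; b; c]]| = 4 by rewrite cardsE (card_uniqP ud).
have close : (forall z, adj a z -> z \in [:: v; a; b; c]) ->
  (forall z, adj c z -> z \in [:: v; a; b; c]) -> good A.
  move=> Ca Cc; apply: (good_order4 _ D4); split.
    by apply/subsetP => z; rewrite inE; cases_in.
  move=> x y; cases_in => h.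
  - by move: h; rewrite Nv; cases_in; rewrite eqxx ?orbT.
  - by have := Ca y h; rewrite !inE.
  - by move: h; rewrite Nb; cases_in; rewrite eqxx ?orbT.
  - by have := Cc y h; rewrite !inE.
have [||s [us ss Na]] := @nbrs a [:: v; b]; [by decide_adj | by rewrite /= av ab |].
have [||s' [us' ss' Nc]] := @nbrs c [:: v; b]; [by decide_adj | by rewrite /= cv cb |].
have := d23 aA; rewrite -ss; have := d23 cA; rewrite -ss'.
have Nv' z : adj v z = (z \in [:: c; b; a]) by rewrite Nv !inE orbC -orbA; case: (z == b);
  rewrite ?orbT.
have Nb' z : adj b z = (z \in [:: v; c; a]) by rewrite Nb !inE; case: (z == v) => //=;
  rewrite orbC.
have ud2 : uniq [:: v; c; b; a] by decide_adj.
case: s us Na {ss} => [|a' [|//]] us Na; case: s' us' Nc {ss'} => [|c' [|//]] us' Nc _ _.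
- by apply: close => z; rewrite ?Na ?Nc; cases_in; rewrite eqxx ?orbT.
- exact: (good_diamond1 ud2 us').
- exact: (good_diamond1 ud us).
have [E|a'c] := eqVneq a' c.
  have ca : adj c a by rewrite adj_sym Na E !inE eqxx !orbT.
  have E' : c' = a by move: ca; rewrite Nc; decide_adj => /eqP ->.
  by apply: close => z; rewrite ?Na ?Nc ?E ?E'; cases_in; rewrite eqxx ?orbT.
apply: (good_diamond2 ud us us') => //; apply: contraNneq a'c => E.
have : adj a c by rewrite adj_sym Nc E !inE eqxx !orbT.
by rewrite Na; decide_adj; rewrite eq_sym.
Qed.

(** Branching at v loses its first term unless both a and b have a further neighbour. If these two
    coincide, ab is the middle edge of a diamond; otherwise the edges aa' and bb' remove five
    vertices each. *)
Lemma good_triangle v a b : v \in A -> uniq [:: v; a; b] ->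
  (forall z, adj v z = (z \in [:: a; b])) -> adj a b -> good A.
Proof.
move=> vA ud Nv ab; have ud' := ud; uniqs ud'.
have va : adj v a by decide_adj. have vb : adj v b by decide_adj.
have av : adj a v by rewrite adj_sym. have bv : adj b v by rewrite adj_sym.
have ba : adj b a by rewrite adj_sym.
have one a0 b0 a' : uniq [:: v; a0; b0] -> uniq [:: v; b0; a'] ->
  (forall z, adj v z = (z \in [:: a0; b0])) ->
    (forall z, adj a0 z = (z \in [:: v; b0; a'])) ->
      (forall z, adj b0 z = (z \in [:: v; a0])) -> good A.
  move=> u1 u2 Nv0 Na Nb; have u1' := u1; uniqs u1'; uniqs u2.
  have na : a0 != a' by apply: (adj_neq gI (A := A)); decide_adj.
  pose L := [:: (v, a0, [:: v; a0; b0; a']); (v, b0, [:: v; a0; b0]);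
               (a0, b0, [:: v; a0; b0; a']); (a0, a', [:: v; a0; b0; a'])].
  have okL : all edge_witness L by decide_adj.
  have n4 : 4 <= n by have /andP [/edge_witness_size] := okL.
  have : 20 * nmx A <= weight L.
    apply: (@branch_closed v [:: a0; b0] L b0) => //;
      [list_edges | by rewrite !inE eqxx orbT | list_closed].
  rewrite /weight !big_cons big_nil /= => le; apply: good_lt; apply: leq_ltn_trans le _.
  have := Q_sub_triangle1 n4; clear; lia.
have [||s [us ss Na]] := @nbrs a [:: v; b]; [by decide_adj | by rewrite /= av ab |].
have [||s' [us' ss' Nb]] := @nbrs b [:: v; a]; [by decide_adj | by rewrite /= bv ba |].
have := d23 (adjA av); rewrite -ss; have := d23 (adjA bv); rewrite -ss'.
case: s us Na {ss} => [|a' [|//]] us Na; case: s' us' Nb {ss'} => [|b' [|//]] us' Nb _ _.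
- pose L := [:: (v, a, [:: v; a; b]); (v, b, [:: v; a; b]); (a, b, [:: v; a; b])].
  have okL : all edge_witness L by decide_adj.
  have n3 : 3 <= n by have /andP [/edge_witness_size] := okL.
  have : 20 * nmx A <= weight L.
    apply: (@branch_closed v [:: a; b] L b) => //;
      [list_edges | by rewrite !inE eqxx orbT | list_closed].
  rewrite /weight !big_cons big_nil /= => le; apply: good_lt; apply: leq_ltn_trans le _.
  have := Q_sub_triangle0 n3; clear; lia.
- apply: (one b a b') => //; first by decide_adj.
  by move=> z; rewrite Nv !inE orbC.
- exact: (one a b a').
uniqs us; uniqs us'.
have [E|a'b'] := eqVneq a' b'.
  subst b'; apply: (@good_diamond a v b a') => //.
    have na : a != a' by apply: (adj_neq gI (A := A)); decide_adj.
    by decide_adj.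
  by move=> z; rewrite Nb !inE orbCA.
have na : a != a' by apply: (adj_neq gI (A := A)); decide_adj.
have nb' : b != b' by apply: (adj_neq gI (A := A)); decide_adj.
have a'a : adj a' a by rewrite adj_sym; decide_adj.
have b'b : adj b' b by rewrite adj_sym; decide_adj.
have [x a'x xa] := other_nb a'a; have na'x := adj_neq gI a'x.
have xv : x != v by apply: contraTneq a'x => ->; rewrite adj_sym; decide_adj.
have xb : x != b by apply: contraTneq a'x => ->; rewrite adj_sym; decide_adj.
have [y b'y yb] := other_nb b'b; have nb'y := adj_neq gI b'y.
have yv : y != v by apply: contraTneq b'y => ->; rewrite adj_sym; decide_adj.
have ya : y != a by apply: contraTneq b'y => ->; rewrite adj_sym; decide_adj.
pose L := [:: (v, a, [:: v; a; b; a']); (v, b, [:: v; a; b; b']); (a, b, [:: v; a; b; a'; b']);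
              (a, a', [:: v; a; b; a'; x]); (b, b', [:: v; a; b; b'; y])].
have okL : all edge_witness L by decide_adj.
have n5 : 5 <= n by have /and4P [_ _ /edge_witness_size] := okL.
have : 20 * nmx A <= Q (n - size [:: v; a; b]) + weight L by apply: branch_nbhd => //; list_edges.
rewrite /weight !big_cons big_nil /= => le; apply: good_lt; apply: leq_ltn_trans le _.
have := Q_sub_triangle2 n5; clear; lia.
Qed.

Hypothesis no_deg2_triangle : forall v a b, v \in A ->
  (forall z, adj v z = (z \in [:: a; b])) -> a != b -> ~~ adj a b.

(** With only a and a2 as neighbours, a1 would be a vertex of degree 2 in a triangle; with degree 3
    a further neighbour is left. *)
Lemma far_nb a a1 a2 : adj a a1 -> adj a a2 -> a1 != a2 ->
  exists x, [/\ adj a1 x, x != a & x != a2].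
Proof.
move=> aa1 aa2 n12; have a1a : adj a1 a by rewrite adj_sym.
have naa2 := adj_neq gI aa2.
have [|s [us ss Ns]] := @nbrs a1 [:: a] isT; first by rewrite /= a1a.
have := d23 (adjA a1a); rewrite -ss; case: s us Ns {ss} => [//|x [|y [|//]]] us Ns _; uniqs us.
  exists x; split; [by decide_adj | by rewrite eq_sym |]; apply/eqP => E; subst x.
  by have := no_deg2_triangle (adjA a1a) Ns naa2; rewrite aa2.
have [E|nx] := eqVneq x a2; last by exists x; split; [decide_adj | rewrite eq_sym |].
by exists y; split; [decide_adj | rewrite eq_sym | rewrite -E eq_sym].
Qed.

(** The edge va removes N[v] and also a1, a2, which lie outside it: [size nv + 3] vertices. Each
    other edge at a removes a, v, a1, a2 and a vertex supplied by [far_nb]. *)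
Lemma side3 v nv a a1 a2 : (forall z, adj v z = (z \in nv)) -> a \in nv -> uniq (v :: nv) ->
  (forall b, b \in nv -> ~~ adj a b) -> uniq [:: v; a1; a2] ->
  (forall z, adj a z = (z \in [:: v; a1; a2])) ->
  exists L, [/\ all edge_witness L, forall b, adj a b -> lists_edge L a b,
                size nv + 3 <= n & weight L = Q (n - (size nv + 3)) + 2 * Q (n - 5)].
Proof.
move=> Nv aN unv Hn u3 Na; uniqs u3.
have va : adj v a by rewrite Nv.
have aa1 : adj a a1 by decide_adj. have aa2 : adj a a2 by decide_adj.
have N1 : a1 \notin nv by apply: contraL aa1 => /Hn.
have N2 : a2 \notin nv by apply: contraL aa2 => /Hn.
have [x [a1x xa xa2]] := far_nb aa1 aa2 ltac:(by []).
have [y [a2y ya ya1]] := far_nb aa2 aa1 ltac:(by rewrite eq_sym).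
have xv : x != v by apply: contraNneq N1 => E; rewrite -Nv adj_sym -E.
have yv : y != v by apply: contraNneq N2 => E; rewrite -Nv adj_sym -E.
have nva := adj_neq gI va. have n1 := adj_neq gI aa1. have n2 := adj_neq gI aa2.
have nx := adj_neq gI a1x. have ny := adj_neq gI a2y.
pose l := (v, a, v :: nv ++ [:: a1; a2]).
pose L := [:: (a, a1, [:: a; v; a1; a2; x]); (a, a2, [:: a; v; a1; a2; y])].
have okl : edge_witness l.
  move: unv => /= /andP [vN uN].
  rewrite /edge_witness /= va eqxx /= all_cat mem_cat negb_or vN cat_uniq uN /=.
  have -> : all (fun z => [|| z == v, z == a, adj v z | adj a z]) nv.
    by apply/allP => z zN; rewrite Nv zN !orbT.
  decide_adj.
  by rewrite N1 N2.
have okL : all edge_witness L by decide_adj.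
exists (l :: L); split.
- by rewrite /= okl.
- move=> b; rewrite Na; cases_in; by rewrite /lists_edge /= !eqxx ?orbT.
- by have := edge_witness_size okl; rewrite /= size_cat /= !addnS.
- by rewrite /weight !big_cons big_nil /= size_cat /= !addnS !addn0 mul2n -addnn.
Qed.

Lemma side2 v nv a a1 : (forall z, adj v z = (z \in nv)) -> a \in nv -> uniq (v :: nv) ->
  size nv = 2 ->
  (forall b, b \in nv -> ~~ adj a b) -> uniq [:: v; a1] ->
  (forall z, adj a z = (z \in [:: v; a1])) ->
  exists L, [/\ all edge_witness L, forall b, adj a b ->
    lists_edge L a b, 4 <= n & weight L = 2 * Q (n - 4)].
Proof.
move=> Nv aN unv s2 Hn u2 Na; uniqs u2.
have va : adj v a by rewrite Nv.
have aa1 : adj a a1 by decide_adj.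
have a1a : adj a1 a by rewrite adj_sym.
have N1 : a1 \notin nv by apply: contraL aa1 => /Hn.
have [x a1x xa] := other_nb a1a.
have xv : x != v by apply: contraNneq N1 => E; rewrite -Nv adj_sym -E.
have nva := adj_neq gI va. have n1 := adj_neq gI aa1. have nx := adj_neq gI a1x.
pose l := (v, a, v :: nv ++ [:: a1]).
pose L := [:: (a, a1, [:: a; v; a1; x])].
have okl : edge_witness l.
  move: unv => /= /andP [vN uN].
  rewrite /edge_witness /= va eqxx /= all_cat mem_cat negb_or vN cat_uniq uN /=.
  have -> : all (fun z => [|| z == v, z == a, adj v z | adj a z]) nv.
    by apply/allP => z zN; rewrite Nv zN !orbT.
  by decide_adj.
have okL : all edge_witness L by decide_adj.
exists (l :: L); split.
- by rewrite /= okl.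
- move=> b; rewrite Na; cases_in; by rewrite /lists_edge /= !eqxx ?orbT.
- by have := edge_witness_size okl; rewrite /= size_cat /= s2.
- by rewrite /weight !big_cons big_nil /= size_cat /= s2 !addn0 mul2n -addnn.
Qed.

Lemma lists_edge_cat L1 L2 a b : lists_edge (L1 ++ L2) a b = lists_edge L1 a b || lists_edge
  L2 a b.
Proof. exact: has_cat. Qed.

Lemma weight_cat L1 L2 : weight (L1 ++ L2) = weight L1 + weight L2.
Proof. by rewrite /weight big_cat. Qed.

(** A neighbour of degree 3 costs [3 * Q (n - 5)], which [Q_step] bounds by the cost [2 * Q (n - 4)]
    of a neighbour of degree 2; both kinds can then be treated alike. *)
Lemma side_deg2 v nv a : (forall z, adj v z = (z \in nv)) -> a \in nv -> uniq (v :: nv) ->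
  size nv = 2 ->
  (forall b, b \in nv -> ~~ adj a b) ->
  exists L, [/\ all edge_witness L, forall b, adj a b ->
    lists_edge L a b, 4 <= n & weight L <= 2 * Q (n - 4)].
Proof.
move=> Nv aN unv s2 Hn; have av : adj a v by rewrite adj_sym Nv.
have [|s [us ss Na]] := @nbrs a [:: v] isT; first by rewrite /= av.
have := d23 (adjA av); rewrite -ss; case: s us Na {ss} => [//|a1 [|a2 [|//]]] us Na _.
  have [L [? ? ? E]] := side2 Nv aN unv s2 Hn us Na.
  by exists L; split=> //; rewrite E.
have [L [? ? + E]] := side3 Nv aN unv Hn us Na.
rewrite s2 => n5; exists L; split=> //; first exact: ltnW.
rewrite E s2; have := Q_step (n - 5).
have -> : (n - 5).+1 = n - 4 by clear -n5; lia.
rewrite (_ : 2 + 3 = 5) //; clear; lia.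
Qed.

Lemma good_deg2 v : v \in A -> deg v = 2 -> good A.
Proof.
move=> vA dv; have [s [us ss Nv]] := @nbrs v [::] isT isT.
rewrite dv in ss; case: s us ss Nv => [//|a [//|b [|//]]] us _ Nv.
have unv : uniq [:: v; a; b].
  by rewrite cons_uniq us andbT -Nv adj_irr.
have nab : a != b by uniqs us.
have nadj := no_deg2_triangle vA Nv nab.
have [|c|La [oka ea n4 wa]] := @side_deg2 v [:: a; b] a Nv _ unv erefl;
  first by rewrite !inE eqxx.
  by cases_in; rewrite ?adj_irr.
have [|c|Lb [okb eb _ wb]] := @side_deg2 v [:: a; b] b Nv _ unv erefl;
  first by rewrite !inE eqxx orbT.
  by cases_in; rewrite ?adj_irr // adj_sym.
have : 20 * nmx A <= Q (n - size [:: v; a; b]) + weight (La ++ Lb).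
  apply: branch_nbhd => //; last by rewrite all_cat oka.
  by move=> p; cases_in => z h; rewrite lists_edge_cat ?ea ?eb ?orbT.
rewrite weight_cat /= => le; apply: good_lt; apply: leq_ltn_trans le _.
have := Q_sub_deg2 n4; clear -wa wb; lia.
Qed.

Hypothesis cubic : forall x, x \in A -> deg x = 3.

Lemma good_cubic2 v a b c : uniq [:: v; a; b; c] ->
  (forall z, adj v z = (z \in [:: a; b; c])) -> adj a b -> adj b c -> good A.
Proof.
move=> ud Nv ab bc; have ud' := ud; uniqs ud'.
have vb : adj v b by decide_adj.
have bv : adj b v by rewrite adj_sym. have ba : adj b a by rewrite adj_sym.
have [||s [us ss Nb]] := @nbrs b [:: v; a; c]; [by decide_adj | by rewrite /= bv ba bc |].
rewrite cubic ?(adjA bv) // in ss; case: s us ss Nb => // us _ Nb.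
exact: good_diamond ud Nv Nb.
Qed.

(** The vertex c, isolated in N(v), contributes through [side3]. The triangle vab is handled as in
    [good_triangle]: a common third neighbour of a and b gives a diamond. *)
Lemma good_cubic1 v a b c : uniq [:: v; a; b; c] ->
  (forall z, adj v z = (z \in [:: a; b; c])) -> adj a b -> ~~ adj a c -> ~~ adj b c -> good A.
Proof.
move=> ud Nv ab nac nbc; have ud' := ud; uniqs ud'.
have va : adj v a by decide_adj. have vb : adj v b by decide_adj. have vc : adj v c by decide_adj.
have vA := adjA va.
have av : adj a v by rewrite adj_sym. have bv : adj b v by rewrite adj_sym.
have cv : adj c v by rewrite adj_sym. have ba : adj b a by rewrite adj_sym.
have [||s [us ss Na]] := @nbrs a [:: v; b]; [by decide_adj | by rewrite /= av ab |].
rewrite cubic ?(adjA av) // in ss; case: s us ss Na => // a' [|//] us _ Na.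
have [||s [us' ss Nb]] := @nbrs b [:: v; a]; [by decide_adj | by rewrite /= bv ba |].
rewrite cubic ?(adjA bv) // in ss; case: s us' ss Nb => // b' [|//] us' _ Nb.
have [||s [us2 ss Nc]] := @nbrs c [:: v]; [by [] | by rewrite /= cv |].
rewrite cubic ?(adjA cv) // in ss; case: s us2 ss Nc => // c1 [//|c2 [|//]] us2 _ Nc.
uniqs us; uniqs us'.
have aa' : adj a a' by decide_adj. have bb' : adj b b' by decide_adj.
have na := adj_neq gI aa'. have nb' := adj_neq gI bb'.
have a'c : a' != c by apply: contraNneq nac => <-.
have b'c : b' != c by apply: contraNneq nbc => <-.
have [E|a'b'] := eqVneq a' b'.
  subst b'; apply: (@good_diamond a v b a') => //; first by decide_adj.
  by move=> z; rewrite Nb !inE orbCA.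
have [x a'x xa] := @other_nb a' a ltac:(by rewrite adj_sym); have na'x := adj_neq gI a'x.
have xv : x != v by apply: contraTneq a'x => ->; rewrite adj_sym; decide_adj.
have xb : x != b by apply: contraTneq a'x => ->; rewrite adj_sym; decide_adj.
have [y b'y yb] := @other_nb b' b ltac:(by rewrite adj_sym); have nb'y := adj_neq gI b'y.
have yv : y != v by apply: contraTneq b'y => ->; rewrite adj_sym; decide_adj.
have ya : y != a by apply: contraTneq b'y => ->; rewrite adj_sym; decide_adj.
have [||L [okL eL n6 wL]] := @side3 v [:: a; b; c] c c1 c2 Nv _ ud _ us2 Nc.
- by rewrite !inE eqxx !orbT.
- by move=> z; cases_in; rewrite ?adj_irr // adj_sym.
pose L1 := [:: (v, a, [:: v; a; b; c; a']); (v, b, [:: v; a; b; c; b']);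
  (a, b, [:: v; a; b; a'; b']);
               (a, a', [:: v; a; b; a'; x]); (b, b', [:: v; a; b; b'; y])].
have okL1 : all edge_witness L1 by decide_adj.
have : 20 * nmx A <= Q (n - size [:: v; a; b; c]) + weight (L1 ++ L).
  apply: branch_nbhd => //; last by rewrite all_cat okL1.
  move=> p; cases_in => z; rewrite lists_edge_cat; last by move/eL ->; rewrite orbT.
    by rewrite Na; cases_in; rewrite [X in X || _]/lists_edge /= !eqxx ?orbT.
  by rewrite Nb; cases_in; rewrite [X in X || _]/lists_edge /= !eqxx ?orbT.
rewrite weight_cat wL /weight !big_cons big_nil /= => le; apply: good_lt;
  apply: leq_ltn_trans le _.
rewrite (_ : 3 + 3 = 6) //; have := Q_sub_cubic1 n6; clear; lia.
Qed.

Lemma good_cubic0 v a b c : uniq [:: v; a; b; c] ->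
  (forall z, adj v z = (z \in [:: a; b; c])) ->
  ~~ adj a b -> ~~ adj a c -> ~~ adj b c -> good A.
Proof.
move=> ud Nv nab nac nbc.
have vA : v \in A by apply: (@adjA v a); rewrite Nv !inE eqxx.
have side x : x \in [:: a; b; c] -> (forall y, y \in [:: a; b; c] -> ~~ adj x y) ->
    exists L, [/\ all edge_witness L, forall y, adj x y ->
      lists_edge L x y, 6 <= n & weight L = Q (n - 6) + 2 * Q (n - 5)].
  move=> xN Hx; have xv : adj x v by rewrite adj_sym Nv.
  have [||s [us ss Nx]] := @nbrs x [:: v]; [by [] | by rewrite /= xv |].
  rewrite cubic ?(adjA xv) // in ss; case: s us ss Nx => // x1 [//|x2 [|//]] us _ Nx.
  have [L [? ? ? ?]] := @side3 v [:: a; b; c] x x1 x2 Nv xN ud Hx us Nx.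
  by exists L.
have [||La [oka ea n6 wa]] := side a; first by rewrite !inE eqxx.
  by move=> z; cases_in; rewrite ?adj_irr.
have [||Lb [okb eb _ wb]] := side b; first by rewrite !inE eqxx orbT.
  by move=> z; cases_in; rewrite ?adj_irr // adj_sym.
have [||Lc [okc ec _ wc]] := side c; first by rewrite !inE eqxx !orbT.
  by move=> z; cases_in; rewrite ?adj_irr // adj_sym.
have : 20 * nmx A <= Q (n - size [:: v; a; b; c]) + weight (La ++ Lb ++ Lc).
  apply: branch_nbhd => //; last by rewrite !all_cat oka okb.
  by move=> p; cases_in => z h; rewrite !lists_edge_cat ?ea ?eb ?ec ?orbT.
rewrite !weight_cat wa wb wc /= => le; apply: good_lt; apply: leq_ltn_trans le _.
have := Q_sub_cubic0 n6; clear; lia.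
Qed.

(** The edges inside N(v) decide: any two of them share a vertex and give a diamond, and up to
    renaming only the cases of one edge or none remain. *)
Lemma good_cubic v : v \in A -> good A.
Proof.
move=> vA; have [s [us ss Nv]] := @nbrs v [::] isT isT.
rewrite cubic // in ss; case: s us ss Nv => [//|a [//|b [//|c [|//]]]] us _ Nv.
have ud : uniq [:: v; a; b; c] by rewrite cons_uniq us andbT -Nv adj_irr.
have perm (s : seq T) : perm_eq s [:: a; b; c] ->
    uniq (v :: s) /\ forall z, adj v z = (z \in s).
  move=> ps; split=> [|z]; last by rewrite Nv; apply/esym/perm_mem.
  by rewrite (perm_uniq (s2 := [:: v; a; b; c])) // perm_cons.
have [u1 N1] := perm [:: b; a; c] (permEl (perm_catCA [:: b] [:: a] [:: c])).
have [u2 N2] := perm [:: a; c; b]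
  ltac:(by rewrite perm_cons; apply: (permEl (perm_catC [:: c] [:: b]))).
have [u3 N3] := perm [:: b; c; a] (permEl (perm_catC [:: b; c] [:: a])).
case ab : (adj a b); case bc : (adj b c); case ac : (adj a c).
- exact: (good_cubic2 ud Nv).
- exact: (good_cubic2 ud Nv).
- by apply: (good_cubic2 u1 N1) => //; rewrite adj_sym.
- by apply: (good_cubic1 ud Nv) => //; rewrite ?bc ?ac.
- by apply: (good_cubic2 u2 N2) => //; rewrite adj_sym.
- by apply: (good_cubic1 u3 N3) => //; rewrite adj_sym ?ab ?ac.
- by apply: (good_cubic1 u2 N2) => //; rewrite ?ab // adj_sym bc.
- by apply: (good_cubic0 ud Nv); rewrite ?ab ?bc ?ac.
Qed.

End Subcubic.

Lemma good_step : 0 < n -> good A.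
Proof.
rewrite card_gt0 => /set0Pn [v0 v0A].
have [/exists_inP [v vA d5]|/exists_inPn d5] := boolP [exists v in A, 5 <= deg v].
  exact: good_deg_ge5 d5.
have d4 x : x \in A -> deg x <= 4 by move/d5; rewrite -ltnNge.
have [/exists_inP [v vA /eqP d0]|/exists_inPn d0] := boolP [exists v in A, deg v == 0].
  exact: good_deg0 d0.
have [/exists_inP [v vA /eqP d1]|/exists_inPn d1] := boolP [exists v in A, deg v == 1].
  exact: good_deg1 d1.
have d24 x : x \in A -> 2 <= deg x <= 4.
  by move=> xA; rewrite d4 // andbT; move: (d0 x xA) (d1 x xA); case: (deg x) => [|[]].
have [/exists_inP [v vA /eqP E4]|/exists_inPn n4] := boolP [exists v in A, deg v == 4].
  exact: good_deg4 E4.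
have d23 x : x \in A -> 2 <= deg x <= 3.
  move=> xA; have /andP [-> le4] := d24 x xA.
  by rewrite -ltnS ltn_neqAle n4.
pose tri := [exists v in A, exists a, exists b, [&& nb v == [set a; b], a != b & adj a b]].
have [/exists_inP [v vA /existsP [a /existsP [b /and3P [/eqP E nab ab]]]]|no_deg2_triangle] :=
  boolP tri.
  have Nv z : adj v z = (z \in [:: a; b]).
    by rewrite -[adj v z]in_set -/(nb v) E !inE.
  apply: (good_triangle d23 vA _ Nv ab); rewrite /= !inE nab andbT.
  by have := adj_irr v; rewrite Nv !inE => ->.
have {}no_deg2_triangle v a b : v \in A -> (forall z, adj v z = (z \in [:: a; b])) -> a != b ->
  ~~ adj a b.
  move=> vA Nv nab; apply: contra no_deg2_triangle => ab; apply/exists_inP; exists v => //.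
  apply/existsP; exists a; apply/existsP; exists b; rewrite nab ab !andbT.
  by apply/eqP/setP => z; rewrite !inE Nv !inE.
have [/exists_inP [v vA /eqP d2]|/exists_inPn d2] := boolP [exists v in A, deg v == 2].
  exact: good_deg2 d2.
apply: (good_cubic d23 no_deg2_triangle _ v0A) => x xA.
by have := d23 x xA; have := d2 x xA; case: (deg x) => [|[|[|[|]]]].
Qed.

End Induction.

(** * The bound for every vertex set, and the theorem *)

Lemma good_all (T : finType) (g : rel T) : symmetric g -> irreflexive g -> forall A, good g A.
Proof.
move=> gS gI A; have [k] := ubnP #|A|; elim: k A => // k IH A ltk.
have [/eqP|A0] := posnP #|A|; last first.
  by apply: good_step => // B BA; apply: IH; apply: leq_trans BA _.
rewrite cards_eq0 => /eqP ->; rewrite /good cards0; split; last first.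
  move=> _; exists (fun=> 0); split=> [x|i|x y]; rewrite ?inE //.
rewrite -[Q 0]/(20 * 1) leq_mul2l /=; apply: (@mx_uniq_le1 _ _ _ set0) => S /mxP [_ + _].
by rewrite subset0 => /eqP.
Qed.

Theorem theorem3p2 (n : nat) (g : rel 'I_n) :
  8 <= n -> simple_graph g ->
  num_max_induced_matchings g <= q_bound n /\
  (num_max_induced_matchings g = q_bound n <->
   graph_iso g (@cliques_rel (extremal_sizes n))).
Proof.
move=> n8 [gS gI]; have [le eqx] := good_all gS gI setT.
rewrite cardsT card_ord q_boundE // in le eqx.
rewrite num_max_induced_matchingsE //; move: le; rewrite leq_pmul2l // => le.
split=> //; split=> [E|iso]; first by apply/ext_iso/eqx; rewrite E.
(* The upper bound is already known, so a union of the prescribed cliques only needs the lower bound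
   by the product of its binomials. *)
apply/eqP; rewrite eqn_leq le -prod_sizes //=; apply: nmx_ext => //.
exact: iso_ext.
Qed.
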